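(* Assume $\int_0^1 p(t)g(t)\,dt=+\infty$. Let $\Phi:\overline{\Omega}\times[0,+\infty)\to\mathbb{R}$ be a Hölder continuous function and let $C\in\mathbb{R}$ be a constant. Then the inequality boundary value problem $$-\Delta u+p(d(x))g(u)\le \Phi(x,u)+C|\nabla u|^2 \ \text{in }\Omega,\qquad u>0\ \text{in }\Omega,\qquad u=0\ \text{on }\partial\Omega$$ has no classical solution $u\in C^2(\Omega)\cap C(\overline{\Omega})$.
   Context: $\Omega\subset\mathbb{R}^N$ ($N\ge 2$) is a bounded domain with smooth boundary and $d(x)=\operatorname{dist}(x,\partial\Omega)$. The function $g\in C^1(0,\infty)$ is positive and decreasing with $\lim_{t\to0^+}g(t)=+\infty$. The function $p:(0,+\infty)\to(0,+\infty)$ is nonincreasing and Hölder continuous. *)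

(* Defs.v *)
From HB Require Import structures.
From mathcomp Require Import all_boot all_order all_algebra.
From mathcomp Require Import all_classical all_reals all_analysis.
Set Implicit Arguments. Unset Strict Implicit. Unset Printing Implicit Defensive.
Import Order.TTheory GRing.Theory Num.Theory.
Import numFieldNormedType.Exports.
Local Open Scope classical_set_scope.
Local Open Scope ring_scope.

Section Defs.
Variables (R : realType) (N : nat).
Notation V := 'rV[R]_N.

Definition evec (i : 'I_N) : V := delta_mx 0 i.

Definition enorm (x : V) : R := Num.sqrt (\sum_i (x 0 i) ^+ 2).

Definition partial (i : 'I_N) (f : V -> R) : V -> R :=
  fun x => 'D_(evec i) f x.

Definition iter_partial (s : seq 'I_N) (f : V -> R) : V -> R :=
  foldr partial f s.

Definition Ck_on (k : nat) (U : set V) (f : V -> R) : Prop :=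
  (forall (s : seq 'I_N) (i : 'I_N) (x : V), (size s < k)%N -> U x ->
      derivable (iter_partial s f) x (evec i)) /\
  (forall (s : seq 'I_N) (x : V), (size s <= k)%N -> U x ->
      {for x, continuous (iter_partial s f)}).

Definition smooth_on (U : set V) (f : V -> R) : Prop :=
  forall k, Ck_on k U f.

Definition laplacian (f : V -> R) (x : V) : R :=
  \sum_i partial i (partial i f) x.
Definition grad_norm2 (f : V -> R) (x : V) : R :=
  \sum_i (partial i f x) ^+ 2.

Definition bdry (A : set V) : set V := closure A `\` interior A.

Definition dist_bdry (A : set V) (x : V) : R :=
  inf [set enorm (x - y) | y in bdry A].

Definition smooth_bounded_domain (A : set V) : Prop :=
  [/\ A !=set0, open A, connected A,
      (exists M : R, forall x, A x -> enorm x <= M) &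
      (forall x0, bdry A x0 ->
        exists (r : R) (phi : V -> R), 0 < r /\ smooth_on (ball x0 r) phi /\
          (forall x, ball x0 r x -> (A x <-> phi x < 0)) /\
          (forall x, ball x0 r x -> phi x = 0 ->
             exists i, partial i phi x != 0))].

Definition loc_holder_pos (f : R -> R) : Prop :=
  forall a b : R, 0 < a -> a <= b ->
    exists (alpha L : R), [/\ 0 < alpha, alpha <= 1, 0 <= L &
      forall s t, a <= s <= b -> a <= t <= b ->
        `|f s - f t| <= L * (`|s - t| `^ alpha)].

Definition loc_holder_closure_halfline (A : set V) (F : V -> R -> R) : Prop :=
  forall M : R, 0 <= M ->
    exists (alpha L : R), [/\ 0 < alpha, alpha <= 1, 0 <= L &
      forall x y s t, closure A x -> closure A y ->
        0 <= s <= M -> 0 <= t <= M ->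
        `|F x s - F y t| <= L * ((enorm (x - y) + `|s - t|) `^ alpha)].

End Defs.

(* Main.v *)
Require Import Defs.
From HB Require Import structures.
From mathcomp Require Import all_boot all_order all_algebra.
From mathcomp Require Import all_classical all_reals all_analysis.
From mathcomp Require Import ring lra measurable_realfun.
Import Order.TTheory GRing.Theory Num.Theory.
Import numFieldNormedType.Exports.
Local Open Scope classical_set_scope.
Local Open Scope ring_scope.
Set Implicit Arguments. Unset Strict Implicit. Unset Printing Implicit Defensive.

(** Let [D = - phi] for a local defining function [phi] of [Omega] near a boundary
    point [x0]. Subsolutions are compared with barriers [psi (D x) + M * |x - z|^2]
    by looking at an interior maximum of the difference, where the gradient of [u]
    is that of the barrier.

    A logarithmic [psi], for which [psi'' = - lam * psi'^2] absorbs the quadratic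
    gradient term, gives [u <= A * D] near [x0]; also [d <= A * D]. As [p] and [g]
    are nonincreasing, [p(d) g(u) >= h (A * D)] with [h = p * g], which is the same
    non-integrable function of the one variable [A * D].

    Since [h] is not integrable at [0], there is a convex [psi] on [[0, delta]] with
    [psi'' <= eps * h], [psi 0 = 0], [psi' 0 = -1], and nevertheless
    [psi delta >= delta]. The comparison with the barrier built on it, centred at
    [x0], forces [u] to be negative on the inner normal direction close to [x0]. *)

(** * One-variable calculus *)

(** Mere continuity of [u] up to the boundary gives no normal derivative to work with, so everything
    is extracted from pointwise comparison in regions [|x - z| <= rho], [D x <= delta] inside one
    chart. The term [M * |x - z|^2] makes this local: it lifts the barrier above [u] on the lateral
    face, leaving the face of largest [D], where the barrier must dominate an a priori bound for
    [u]. In the second comparison this bound is [u <= A * D], so the linear estimate serves twice: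
    it reduces [p(d) g(u)] to one variable, and it makes [psi delta >= delta] the right demand after
    the rescaling [t = A * D]. A slope starting at -1 must then climb by a fixed amount over an
    arbitrarily short interval with only [eps * h] to drive it; this is where the divergence enters.
    The slope stays in [-1, 3] and [M] is proportional to [delta], so the remaining terms are
    bounded independently of [delta], and the blow-up of [h] at 0 absorbs them. At distance [s] from
    [x0] the profile is negative of order [s], whereas the quadratic term is of order [s^2]. *)

Lemma is_derive_line (R : realType) (V : normedModType R) (f : V -> R)
    (x v : V) (s l : R) :
  is_derive (x + s *: v) v f l <->
  is_derive s 1 (fun t : R => f (x + t *: v)) l.
Proof.
have E : (fun h : R => h^-1 *: ((f \o shift (x + s *: v)) (h *: v) - f (x + s *: v)))
  = (fun h : R => h^-1 *: (((fun t : R => f (x + t *: v)) \o shift s) (h *: 1) -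
       (fun t : R => f (x + t *: v)) s)).
  apply/funext => h /=; congr (_ *: (f _ - _)).
  by rewrite [h *: 1]mulr1 scalerDl addrCA.
have D : derivable f (x + s *: v) v = derivable (fun t : R => f (x + t *: v)) s 1.
  by rewrite /derivable E.
have D' : 'D_v f (x + s *: v) = 'D_1 (fun t : R => f (x + t *: v)) s.
  by rewrite /derive E.
split => -[d e]; apply: DeriveDef.
- by rewrite -D.
- by rewrite -D'.
- by rewrite D.
- by rewrite D'.
Qed.

Lemma is_derive_continuous (R : realType) (f : R -> R) (x l : R) :
  is_derive x 1 f l -> {for x, continuous f}.
Proof.
by move=> [d _]; apply: differentiable_continuous; apply/derivable1_diffP.
Qed.

Lemma MVT_is_derive (R : realType) (f df : R -> R) (a b : R) : a < b ->
  (forall x : R, a <= x <= b -> is_derive x 1 f (df x)) ->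
  exists2 c, a < c < b & f b - f a = df c * (b - a).
Proof.
move=> ab d.
have [||c] := @MVT R f df a b ab.
- by move=> x; rewrite in_itv /= => /andP[/ltW ax /ltW xb]; apply: d; rewrite ax.
- apply: continuous_in_subspaceT => x.
  by rewrite inE /= in_itv /= => /d /is_derive_continuous.
- by rewrite in_itv /= => cab e; exists c.
Qed.

Lemma is_derive_near_right (R : realType) (f : R -> R) (a l e : R) :
  is_derive a 1 f l -> 0 < e ->
  exists2 d : R, 0 < d &
    forall s, 0 < s < d -> `|f (a + s) - f a - l * s| <= e * s.
Proof.
move=> [+ <-] e0; rewrite /derivable => /cvg_ex[l' dl].
have -> : 'D_1 f a = l' by exact/cvg_lim.
move/cvgrPdist_le/(_ _ e0): dl => -[d /= d0 H].
exists d => // s /andP[s0 sd].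
have := H s; rewrite /ball_ /= sub0r normrN gtr0_norm // => /(_ sd).
rewrite gt_eqF // => /(_ isT).
rewrite [s *: 1]mulr1 [s + a]addrC -[_ *: _]/(s^-1 * (f (a + s) - f a)) => Hs.
have -> : f (a + s) - f a - l' * s = - (s * (l' - s^-1 * (f (a + s) - f a))).
  by field; rewrite gt_eqF.
by rewrite normrN normrM gtr0_norm // mulrC ler_wpM2r // ltW.
Qed.

(** If [l > 0], the expansion of [f1] at 0 makes it positive on a right neighbourhood, and the mean
    value theorem gives a value of [f] above [f 0]. Differentiability of [f1] at the single point 0
    suffices. *)
Lemma second_derivative_test (R : realType) (f f1 : R -> R) (l e : R) :
  0 < e -> (forall s : R, `|s| < e -> is_derive s 1 f (f1 s)) ->
  is_derive (0 : R) 1 f1 l -> (forall s, `|s| < e -> f s <= f 0) ->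
  f1 0 = 0 /\ l <= 0.
Proof.
move=> e0 df df1 fmax.
have I t : t \in `]-e, e[%R -> `|t| < e by rewrite in_itv /= ltr_norml.
have z : is_derive (0 : R) 1 f 0.
  apply: (@derive1_at_max _ f (- e) e); first by lra.
  - by move=> t /I/df[].
  - by rewrite in_itv /=; lra.
  - by move=> t /I/fmax.
have f10 : f1 0 = 0.
  have [_ <-] : is_derive (0 : R) 1 f (f1 0) by apply: df; rewrite normr0.
  by case: z.
split => //; rewrite leNgt; apply/negP => l0.
have [|d d0 H] := @is_derive_near_right _ f1 0 l (l / 2) df1; first by lra.
pose s := Num.min d e / 2.
have m0 : 0 < Num.min d e by rewrite lt_min d0 e0.
have md : Num.min d e <= d by rewrite ge_min lexx.
have me : Num.min d e <= e by rewrite ge_min lexx orbT.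
have s0 : 0 < s by rewrite /s; lra.
have sd : s < d by rewrite /s; lra.
have se : s < e by rewrite /s; lra.
have [|c /andP[c0 cs] E] := @MVT_is_derive _ f f1 0 s s0.
  by move=> x /andP[x0 xs]; apply: df; rewrite ger0_norm // (le_lt_trans xs).
have := H c; rewrite add0r f10 subr0 c0 (lt_trans cs sd) => /(_ isT).
rewrite ler_norml => /andP[Hc _].
have f1c : 0 < f1 c by nra.
have := fmax s; rewrite gtr0_norm // => /(_ se).
have : 0 < f1 c * (s - 0) by rewrite subr0 mulr_gt0.
lra.
Qed.

(** * A convex profile from a divergent integral *)

(** The primitive is the integral from [a']. The margins [a < a'] and [b' < b] place the closed
    segment inside the region of continuity, which gives integrability. *)
Lemma exists_primitive (R : realType) (k : R -> R) (a b a' b' : R) :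
  a < a' -> b' < b -> (forall x : R, a < x < b -> {for x, continuous k}) ->
  exists F : R -> R, forall x : R, a' < x < b' -> is_derive x 1 F (k x).
Proof.
move=> aa' b'b ck.
exists (fun x => \int[lebesgue_measure]_(t in `[a', x]) k t) => x /andP[a'x xb'].
have ki : lebesgue_measure.-integrable `[a', b'] (EFin \o k).
  apply: continuous_compact_integrable; first exact: segment_compact.
  apply: continuous_in_subspaceT => y; rewrite inE /= in_itv /= => /andP[a'y yb'].
  by apply: ck; rewrite (lt_le_trans aa' a'y) (le_lt_trans yb' b'b).
have [||d e] := @continuous_FTC1_closed R k a' x b' xb' ki.
- exact: a'x.
- by apply: ck; rewrite (lt_trans aa' a'x) (lt_trans xb' b'b).
apply: DeriveDef; first exact: d.
by rewrite -derive1E e.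
Qed.

(** Were all these integrals below [B], monotone convergence would bound the integral over []0, a]];
    adding the finite part over []a, 1]] contradicts divergence. *)
Lemma integral_near0_unbounded (R : realType) (h : R -> R) :
  (forall t : R, 0 < t -> {for t, continuous h}) -> (forall t : R, 0 < t -> 0 < h t) ->
  (\int[@lebesgue_measure R]_(t in `]0%R, 1%R]) (h t)%:E = +oo)%E ->
  forall a B : R, 0 < a -> a <= 1 -> exists2 tau, 0 < tau < a &
    (B%:E <= \int[@lebesgue_measure R]_(t in `[tau, a]) (h t)%:E)%E.
Proof.
move=> ch h0 hoo a B a0 a1.
have mh (D : set (measurableTypeR R)) : measurable D -> D `<=` `]0, +oo[%classic ->
    measurable_fun D (fun t : measurableTypeR R => (h t)%:E).
  move=> mD D0; apply/measurable_EFinP.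
  apply: subspace_continuous_measurable_fun => //.
  apply: continuous_in_subspaceT => y; rewrite inE => /D0 /=.
  by rewrite in_itv /= andbT => /ch.
apply: contrapT => /forall2NP H.
(* The shift [i.+2] keeps the left endpoint strictly below [a] even for [i = 0], so that each
   endpoint is an admissible [tau]. *)
pose F i : set R := `[a / i.+2%:R, a]%classic.
have Fpos i : 0 < a / i.+2%:R < a.
  rewrite divr_gt0 //= ltr_pdivrMr // ltr_pMr // ltr1n //.
have lim_le : (\int[@lebesgue_measure R]_(t in \bigcup_i F i) (h t)%:E <= B%:E)%E.
  have Fsub i : F i `<=` `]0, +oo[.
    move=> t; rewrite /F /= !in_itv /= andbT => /andP[+ _].
    by apply: lt_le_trans; have /andP[] := Fpos i.
  have cv : (\int[@lebesgue_measure R]_(t in F i) (h t)%:E)%E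
      @[i --> \oo] --> (\int[@lebesgue_measure R]_(t in \bigcup_i F i) (h t)%:E)%E.
    apply: ge0_nondecreasing_set_cvg_integral => //.
    - apply/nondecreasing_seqP => n; apply/subsetPset => t.
      rewrite /F /= !in_itv /= => /andP[ht ->]; rewrite andbT.
      apply: le_trans ht; rewrite ler_pM2l // lef_pV2 ?posrE ?ltr0n //.
      by rewrite ler_nat.
    - by move=> i; exact: measurable_itv.
    - by move=> i; exact: mh (measurable_itv _) (@Fsub i).
    - by move=> i t /Fsub; rewrite /= in_itv /= andbT lee_fin => /h0/ltW.
  apply: (cvge_to_le cv); apply: nearW => i; case: (H (a / i.+2%:R)) => [/negP|/negP].
    by rewrite Fpos.
  by rewrite -ltNge => /ltW.
have UF : \bigcup_i F i = `]0, a]%classic.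
  apply/seteqP; split => t.
    move=> [i _]; rewrite /F /= !in_itv /= => /andP[it ->]; rewrite andbT.
    by apply: lt_le_trans it; have /andP[] := Fpos i.
  rewrite /= in_itv /= => /andP[t0 ta].
  exists (Num.truncn (a / t)) => //; rewrite /F /= in_itv /= ta andbT.
  rewrite ler_pdivrMr // mulrC -ler_pdivrMr //.
  apply/ltW/(lt_trans (truncnS_gt _)).
  by rewrite ltr_nat.
have fin : (\int[@lebesgue_measure R]_(t in `]a, 1%R]) (h t)%:E < +oo)%E.
  have ki : lebesgue_measure.-integrable `[a, 1%R] (EFin \o h).
    apply: continuous_compact_integrable; first exact: segment_compact.
    apply: continuous_in_subspaceT => y; rewrite inE /= in_itv /= => /andP[ay _].
    exact/ch/(lt_le_trans a0).
  have : lebesgue_measure.-integrable `]a, 1%R] (EFin \o h).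
    apply: integrableS ki => //; try exact: measurable_itv.
    by move=> t /=; rewrite !in_itv /= => /andP[/ltW -> ->].
  by apply: integrable_lty; exact: measurable_itv.
have : (\int[@lebesgue_measure R]_(t in `]0%R, 1%R]) (h t)%:E < +oo)%E.
  have -> : `]0%R, 1%R]%classic = `]0%R, a]%classic `|` `]a, 1%R]%classic :> set R.
    by rewrite -itv_bndbnd_setU // bnd_simp // ltW.
  rewrite ge0_integral_setU //=.
  - rewrite -UF; apply: lte_add_pinfty => //.
    by apply: le_lt_trans lim_le _; rewrite ltry.
  - apply: mh; first exact: measurableU.
    move=> t [] /=; rewrite !in_itv /= andbT => /andP[] // + _.
    exact: lt_trans.
  - move=> t []; rewrite /= !in_itv /= lee_fin => /andP[+ _].
      by move=> /h0/ltW.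
    by move=> /(lt_trans a0)/h0/ltW.
  - rewrite disj_set2E; apply/eqP; rewrite -subset0 => t [] /=.
    rewrite !in_itv /= => /andP[_ ta] /andP[at_ _].
    by have := lt_le_trans at_ ta; rewrite ltxx.
by rewrite hoo ltxx.
Qed.

Lemma is_derive_affine_comp (R : realType) (F : R -> R) (x l a b : R) :
  is_derive x 1 F l -> is_derive x 1 (fun t => a + b * (F t - F 0)) (b * l).
Proof.
move=> d.
have H1 := @is_deriveB _ _ _ F (cst (F 0)) x 1 l 0 d (is_derive_cst _ _ _).
have H2 := @is_deriveZ _ _ _ _ b x 1 _ H1.
have H3 := @is_deriveD _ _ _ (cst a) _ x 1 0 _ (is_derive_cst _ _ _) H2.
move: H3; rewrite add0r subr0.
apply.
Qed.

(* [psi1] climbs from [-1] to [3] and already reaches [2] at [delta / 4]: its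
   derivative is [eps * h] frozen on [[0, tau]] and rescaled by [theta <= 1] to have
   total mass [4]. *)
Lemma convex_profile (R : realType) (h : R -> R) (delta eps : R) :
  (forall t : R, 0 < t -> {for t, continuous h}) ->
  (forall t : R, 0 < t -> 0 < h t) ->
  (forall s t : R, 0 < s -> s <= t -> h t <= h s) ->
  (\int[@lebesgue_measure R]_(t in `]0%R, 1%R]) (h t)%:E = +oo)%E ->
  0 < delta -> delta <= 1 -> 0 < eps ->
  exists psi psi1 psi2 : R -> R,
    [/\ forall t : R, - (1 / 2) < t < 3 / 2 ->
          is_derive t 1 psi (psi1 t) /\ is_derive t 1 psi1 (psi2 t),
        psi 0 = 0, psi1 0 = -1, delta <= psi delta &
        forall t, 0 <= t <= delta ->
          [/\ - t <= psi t, -1 <= psi1 t <= 3, 0 <= psi2 t &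
              0 < t -> psi2 t <= eps * h t]].
Proof.
move=> ch h0 hd hoo d0 d1 e0.
(* [c] bounds the increase of the unscaled slope on [[delta / 4, delta]]. Demanding total mass at
   least [4 + 4 * c] gives both [theta <= 1] and [theta * c <= 1], so at most 1 of the climb to 3 is
   left after [delta / 4]. *)
pose c := eps * h (delta / 4) * delta.
have q0 : 0 < delta / 4 by lra.
have c0 : 0 < c by rewrite /c !mulr_gt0 // h0.
have [||tau /andP[tau0 taud] Hint] :=
    @integral_near0_unbounded R h ch h0 hoo delta ((4 + 4 * c) / eps).
- by [].
- by [].
(* Freezing at [tau] makes [k] continuous through 0, so the profile is defined on both sides of
   [D = 0]; since [h] is nonincreasing, [k] stays below [eps * h]. *)
pose k t := eps * h (Num.max t tau).
have ck (t : R) : {for t, continuous k}.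
  have mt : 0 < Num.max t tau by rewrite lt_max tau0 orbT.
  rewrite /k; apply: (@cvgM _ _ _ _ (cst eps) (fun t => h (Num.max t tau))).
    exact: cvg_cst.
  apply: (@continuous_comp _ _ _ (fun t => Num.max t tau) h); last exact: ch.
  by apply: (@continuous_max _ _ (@idfun R) (cst tau)); [exact: cvg_id | exact: cvg_cst].
have k0 (t : R) : 0 <= k t by rewrite mulr_ge0 ?ltW // h0 // lt_max tau0 orbT.
have kh (t : R) : 0 < t -> k t <= eps * h t.
  by move=> t0; rewrite ler_pM2l // hd // le_max lexx.
(* Each integration costs a margin: from (-2, 3) to (-1, 2), then to (-1/2, 3/2), which still
   surrounds [[0, delta]] because [delta <= 1]. *)
have [K dK] : exists K : R -> R, forall t : R, -1 < t < 2 -> is_derive t 1 K (k t).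
  by apply: (@exists_primitive R k (-2) 3) => //; lra.
have Kmono (s t : R) : -1 < s -> s <= t -> t < 2 -> K s <= K t.
  rewrite le_eqVlt => s1 /orP[/eqP-> //|st] t2.
  have [|y /andP[sy yt] E] := @MVT_is_derive R K k s t st.
    by move=> y /andP[sy yt]; apply: dK; rewrite (lt_le_trans s1 sy) (le_lt_trans yt t2).
  by rewrite -subr_ge0 E mulr_ge0 // subr_ge0 ltW.
have Kbig : 4 + 4 * c <= K delta - K 0.
  apply: (@le_trans _ _ (K delta - K tau)); last first.
    by rewrite lerD2l lerN2; apply: Kmono; lra.
  have FTC : (\int[@lebesgue_measure R]_(t in `[tau, delta]) (k t)%:E =
      (K delta)%:E - (K tau)%:E)%E.
    apply: continuous_FTC2 => //.
    - by apply: continuous_subspaceT => t; exact: ck.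
    - split.
      + move=> t; rewrite in_itv /= => /andP[t1 t2].
        by have [] : is_derive t 1 K (k t) by apply: dK; lra.
      + by apply: cvg_at_right_filter; apply: (@is_derive_continuous R K _ (k tau)); apply: dK; lra.
      + by apply: cvg_at_left_filter; apply: (@is_derive_continuous R K _ (k delta)); apply: dK; lra.
    - move=> t; rewrite in_itv /= => /andP[t1 t2]; rewrite derive1E.
      by have [_ ->] : is_derive t 1 K (k t) by apply: dK; lra.
  have E : (\int[@lebesgue_measure R]_(t in `[tau, delta]) (k t)%:E =
     eps%:E * \int[@lebesgue_measure R]_(t in `[tau, delta]) (h t)%:E)%E.
    rewrite -ge0_integralZl //.
    - apply: eq_integral => t; rewrite inE /= in_itv /= => /andP[tt _].
      by rewrite -EFinM /k max_l.
    - apply/measurable_EFinP.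
      apply: subspace_continuous_measurable_fun; first exact: measurable_itv.
      apply: continuous_in_subspaceT => y; rewrite inE /= in_itv /= => /andP[ty _].
      by apply: ch; exact: lt_le_trans ty.
    - move=> y; rewrite /= in_itv /= lee_fin => /andP[ty _].
      by apply/ltW/h0; exact: lt_le_trans ty.
    - by rewrite lee_fin ltW.
  have : (eps%:E * ((4 + 4 * c) / eps)%:E <= (K delta)%:E - (K tau)%:E)%E.
    by rewrite -FTC E lee_pmul2l.
  by rewrite -EFinM -EFinB lee_fin mulrC divfK // gt_eqF.
pose T := K delta - K 0; pose theta := 4 / T.
have T0 : 0 < T by rewrite /T; lra.
have th0 : 0 < theta by rewrite divr_gt0.
have th1 : theta <= 1 by rewrite ler_pdivrMr // mul1r /T; lra.
have thT : theta * T = 4 by rewrite /theta; field; rewrite gt_eqF.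
pose psi1 t := -1 + theta * (K t - K 0).
have dpsi1 (t : R) : -1 < t < 2 -> is_derive t 1 psi1 (theta * k t).
  by move=> ht; apply: is_derive_affine_comp; apply: dK.
have [P dP] : exists P : R -> R,
    forall t : R, - (1 / 2) < t < 3 / 2 -> is_derive t 1 P (psi1 t).
  apply: (@exists_primitive R psi1 (-1) 2); [lra | lra |].
  by move=> x /dpsi1 /is_derive_continuous.
have psi1mono (s t : R) : -1 < s -> s <= t -> t < 2 -> psi1 s <= psi1 t.
  by move=> ? ? ?; rewrite lerD2l ler_pM2l // lerD2r; apply: Kmono.
have psi10 : psi1 0 = -1 by rewrite /psi1 subrr mulr0 addr0.
have psi1d : psi1 delta = 3 by rewrite /psi1 -/T thT; lra.
have psi1q : 2 <= psi1 (delta / 4).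
  have [||y /andP[y1 y2] E] := @MVT_is_derive R K k (delta / 4) delta.
  - lra.
  - by move=> y /andP[y1 y2]; apply: dK; lra.
  have ky : k y <= eps * h (delta / 4).
    apply: le_trans (kh _ _) _; first by lra.
    by rewrite ler_pM2l // hd // ltW.
  have : K delta - K (delta / 4) <= c.
    rewrite E /c; apply: ler_pM => //; first by lra.
    lra.
  move=> Kc.
  have -> : psi1 (delta / 4) = 3 - theta * (K delta - K (delta / 4)).
    by rewrite -psi1d /psi1; ring.
  suff : theta * (K delta - K (delta / 4)) <= 1 by lra.
  apply: le_trans (_ : theta * c <= 1); first by rewrite ler_pM2l.
  rewrite /theta mulrAC ler_pdivrMr // mul1r /T; lra.
pose psi t := P t - P 0.
have dpsi (t : R) : - (1 / 2) < t < 3 / 2 -> is_derive t 1 psi (psi1 t).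
  move=> ht; have := @is_derive_affine_comp R P t (psi1 t) 0 1 (dP t ht).
  rewrite mul1r; congr (is_derive _ _ _ _).
  by apply/funext => s; rewrite add0r mul1r.
have psimvt (s t l : R) : - (1 / 2) < s -> s <= t -> t < 3 / 2 -> l <= psi1 s ->
    l * (t - s) <= psi t - psi s.
  rewrite le_eqVlt => s1 /orP[/eqP->|st] t2 ls; first by rewrite !subrr mulr0.
  have [|y /andP[sy yt] ->] := @MVT_is_derive R psi psi1 s t st.
    by move=> y /andP[sy yt]; apply: dpsi; lra.
  rewrite ler_pM2r ?subr_gt0 //; apply: le_trans ls _; apply: psi1mono; lra.
have psi0 : psi 0 = 0 by rewrite /psi subrr.
exists psi, psi1, (fun t => theta * k t); split.
- by move=> t ht; split; [exact: dpsi | apply: dpsi1; lra].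
- exact: psi0.
- exact: psi10.
(* Slope at least -1 on the first quarter and at least 2 on the rest give
   [psi delta >= - delta / 4 + 3 * delta / 2], which exceeds [delta]. *)
- have H1 : -1 * (delta / 4 - 0) <= psi (delta / 4) - psi 0.
    by apply: psimvt; rewrite ?psi10; lra.
  have H2 : 2 * (delta - delta / 4) <= psi delta - psi (delta / 4).
    by apply: psimvt => //; lra.
  by lra.
- move=> t /andP[t0 td]; split.
  + have : -1 * (t - 0) <= psi t - psi 0 by apply: psimvt; rewrite ?psi10; lra.
    by rewrite psi0; lra.
  + by rewrite -{1}psi10 -psi1d !psi1mono //; lra.
  + by rewrite mulr_ge0 // ltW.
  + move=> tp; apply: le_trans (kh _ tp).
    by rewrite -[leRHS]mul1r ler_wpM2r.
Qed.

(** * Boundary charts *)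

(** The square of [enorm], kept without the root so that barriers are smooth at their centre. The
    norm [|x|] on row vectors, and hence [ball], is the maximum norm, which explains the factors [N]
    in later estimates. *)
Definition sqnorm {R : realType} {N : nat} (x : 'rV[R]_N) : R :=
  \sum_i (x 0 i) ^+ 2.

Lemma sqnorm_ge0 (R : realType) (N : nat) (x : 'rV[R]_N) : 0 <= sqnorm x.
Proof. by apply: sumr_ge0 => i _; exact: sqr_ge0. Qed.

Lemma sqr_enorm (R : realType) (N : nat) (x : 'rV[R]_N) :
  enorm x ^+ 2 = sqnorm x.
Proof. by rewrite sqr_sqrtr // sqnorm_ge0. Qed.

Lemma sqnormZ (R : realType) (N : nat) (a : R) (x : 'rV[R]_N) :
  sqnorm (a *: x) = a ^+ 2 * sqnorm x.
Proof.
by rewrite /sqnorm mulr_sumr; apply: eq_bigr => i _; rewrite mxE exprMn.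
Qed.

Lemma sqr_normr_le_sqnorm (R : realType) (N : nat) (x : 'rV[R]_N) :
  `|x| ^+ 2 <= sqnorm x.
Proof.
have [->|x0] := eqVneq x 0; first by rewrite normr0 expr0n /= sqnorm_ge0.
have : mx_norm x != 0 by apply: contra_neq x0; exact: mx_norm_eq0.
move=> /mx_norm_neq0 [[i j] /= E].
have -> : `|x| = `|x i j| by exact: E.
rewrite real_normK ?num_real // (ord1 i) /sqnorm (bigD1 j) //= lerDl.
by apply: sumr_ge0 => k _; exact: sqr_ge0.
Qed.

Lemma normrZ_unit_le (R : realType) (N : nat) (e : 'rV[R]_N) (s : R) :
  sqnorm e = 1 -> `|s *: e| <= `|s|.
Proof.
move=> e1; rewrite -(@ler_pXn2r _ 2) ?nnegrE //.
apply: le_trans (sqr_normr_le_sqnorm _) _.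
by rewrite sqnormZ e1 mulr1 real_normK ?num_real.
Qed.

Lemma normr_coord_le (R : realType) (N : nat) (x : 'rV[R]_N) (i : 'I_N) :
  `|x 0 i| <= `|x|.
Proof.
rewrite {2}/Num.Def.normr /= mx_normrE.
by apply/bigmax_geP; right => /=; exists (0, i).
Qed.

Lemma sqnorm_le (R : realType) (N : nat) (x : 'rV[R]_N) :
  sqnorm x <= N%:R * `|x| ^+ 2.
Proof.
rewrite -[N in N%:R]card_ord mulr_natl -sumr_const; apply: ler_sum => i _.
rewrite -[leLHS]real_normK ?num_real // ler_pXn2r ?nnegrE //.
exact: normr_coord_le.
Qed.

Lemma normr_le_enorm (R : realType) (N : nat) (x : 'rV[R]_N) : `|x| <= enorm x.
Proof.
rewrite -(@ler_pXn2r _ 2) ?nnegrE //; first by rewrite sqr_enorm sqr_normr_le_sqnorm.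
exact: sqrtr_ge0.
Qed.

Lemma sqnorm_evec (R : realType) (N : nat) (i : 'I_N) : sqnorm (evec R i) = 1.
Proof.
rewrite /sqnorm (bigD1 i) //= big1 ?addr0; first by rewrite mxE !eqxx expr1n.
by move=> k ki; rewrite mxE eqxx /= (negbTE ki) expr0n.
Qed.

Lemma sqnormD_evec (R : realType) (N : nat) (y : 'rV[R]_N) (i : 'I_N) (s : R) :
  sqnorm (y + s *: evec R i) = sqnorm y + (2 * y 0 i * s + s ^+ 2).
Proof.
rewrite /sqnorm (bigD1 i) //= [in RHS](bigD1 i) //= !mxE !eqxx /= mulr1.
rewrite (eq_bigr (fun k => y 0 k ^+ 2)); first by ring.
by move=> k ki; rewrite !mxE eqxx (negbTE ki) /= mulr0 addr0.
Qed.

Lemma ball_convex (R : realType) (N : nat) (z x e : 'rV[R]_N) (r s t : R) :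
  ball z r x -> ball z r (x + t *: e) -> 0 <= s <= t -> ball z r (x + s *: e).
Proof.
move=> bx bt /andP[s0 st].
have [t0|t0] := eqVneq t 0.
  have -> : s = 0 by apply/eqP; rewrite eq_le s0 andbT -t0.
  by rewrite scale0r addr0.
have tp : 0 < t by rewrite lt_neqAle eq_sym t0 (le_trans s0 st).
move: bx bt; rewrite -ball_normE /ball_ /= => bx bt.
have -> : z - (x + s *: e) = (1 - s / t) *: (z - x) + (s / t) *: (z - (x + t *: e)).
  by apply/rowP => i; rewrite !mxE; field.
have q0 : 0 <= s / t by rewrite divr_ge0 // ltW.
have q1 : s / t <= 1 by rewrite ler_pdivrMr // mul1r.
apply: (le_lt_trans (ler_normD _ _)); rewrite !normrZ !ger0_norm ?subr_ge0 //.
have [E|q2] := eqVneq (s / t) 0; first by rewrite E subr0 mul1r mul0r addr0.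
have q3 : 0 < s / t by rewrite lt_neqAle eq_sym q2.
have A : (1 - s / t) * `|z - x| <= (1 - s / t) * r by rewrite ler_wpM2l ?subr_ge0 // ltW.
have B : s / t * `|z - (x + t *: e)| < s / t * r by rewrite ltr_pM2l.
have -> : r = (1 - s / t) * r + s / t * r by ring.
  exact: ler_ltD.
by rewrite invr_ge0 ltW.
Qed.

(** Since [Omega] is [phi < 0] in the ball, the unit vector [e], along which [phi] grows at rate at
    least [c], points outward. The constants are uniform over the ball, so barrier parameters can be
    chosen before the centre; the pure second derivatives are those that enter the Laplacian. *)
Record chart (R : realType) (N : nat) (Omega : set 'rV[R]_N)
    (phi : 'rV[R]_N -> R) (x0 e : 'rV[R]_N) (r c K : R) : Prop := Chart {
  chart_r_gt0 : 0 < r;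
  chart_c_gt0 : 0 < c;
  chart_unit : sqnorm e = 1;
  chart_mem : forall x, ball x0 r x -> (Omega x <-> phi x < 0);
  chart_continuous : forall x, ball x0 r x -> {for x, continuous phi};
  chart_derivable : forall x i, ball x0 r x -> derivable phi x (evec R i);
  chart_derivable2 : forall x i, ball x0 r x ->
    derivable (partial i phi) x (evec R i);
  chart_bound1 : forall x i, ball x0 r x -> `|partial i phi x| <= K;
  chart_bound2 : forall x i, ball x0 r x -> `|partial i (partial i phi) x| <= K;
  chart_slope : forall x, ball x0 r x ->
    exists2 l, is_derive x e phi l & c <= l;
  chart_grad : forall x, ball x0 r x -> c ^+ 2 <= grad_norm2 phi x }.

Lemma ball_sub_ball (R : realType) (N : nat) (x0 x : 'rV[R]_N) (r : R) :
  ball x0 r x -> exists2 d : R, 0 < d & ball x d `<=` ball x0 r.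
Proof.
rewrite -ball_normE /ball_ /= => bx; exists (r - `|x0 - x|).
  by rewrite subr_gt0.
move=> y; rewrite /= => xy.
have -> : x0 - y = (x0 - x) + (x - y) by rewrite addrA subrK.
by apply: le_lt_trans (ler_normD _ _) _; rewrite -ltrBrDl.
Qed.

(** If [phi x > 0], a neighbourhood of [x] in the ball misses [Omega]. It is stated without [chart]
    because [exists_chart] uses it to show that [phi] vanishes at [x0]. *)
Lemma closure_le0 (R : realType) (N : nat) (Omega : set 'rV[R]_N)
    (phi : 'rV[R]_N -> R) (x0 x : 'rV[R]_N) (r : R) :
  (forall y, ball x0 r y -> Omega y -> phi y < 0) ->
  {for x, continuous phi} -> ball x0 r x -> closure Omega x -> phi x <= 0.
Proof.
move=> Op cphi bx cx; rewrite leNgt; apply/negP => px.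
have np : \forall y \near x, 0 < phi y.
  by apply: (cphi [set y | 0 < y]); apply: lt_nbhsr.
have [d d0 db] := ball_sub_ball bx.
have nb : nbhs x (ball x0 r) by apply/nbhs_ballP; exists d.
have [y [Oy [p b]]] : Omega `&` [set y | 0 < phi y /\ ball x0 r y] !=set0.
  by apply: cx; apply: filterS2 np nb => y.
by move: Oy => /(Op _ b); rewrite ltNge ltW.
Qed.

Section Chart.
Variables (R : realType) (N : nat) (Omega : set 'rV[R]_N).
Variables (phi : 'rV[R]_N -> R) (x0 e : 'rV[R]_N) (r c K : R).
Hypothesis ch : chart Omega phi x0 e r c K.

Lemma ball_step (x : 'rV[R]_N) (d s : R) : `|s| < d -> ball x d (x + s *: e).
Proof.
move=> sd; rewrite -ball_normE /ball_ /= opprD addrA subrr sub0r normrN.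
by apply: le_lt_trans sd; exact: normrZ_unit_le (chart_unit ch).
Qed.

Lemma chart_growth (x : 'rV[R]_N) (t : R) : 0 <= t ->
  ball x0 r x -> ball x0 r (x + t *: e) -> phi x + c * t <= phi (x + t *: e).
Proof.
rewrite le_eqVlt => /orP[/eqP<- _ _|t0 bx bt].
  by rewrite mulr0 scale0r !addr0.
have bs s : 0 <= s <= t -> ball x0 r (x + s *: e) by exact: ball_convex.
pose f s := phi (x + s *: e).
have fd (s : R) : 0 <= s <= t -> is_derive s 1 f ('D_e phi (x + s *: e)).
  move=> /bs/(chart_slope ch)[l dl _].
  have -> : 'D_e phi (x + s *: e) = l by case: dl.
  exact: (proj1 (@is_derive_line R _ phi x e s l) dl).
have [s /andP[s0 st] E] := @MVT_is_derive R f (fun s => 'D_e phi (x + s *: e)) 0 t t0 fd.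
have [|l dl cl] := chart_slope ch (x := x + s *: e).
  by apply: bs; rewrite !ltW.
move: E; rewrite subr0 /f scale0r addr0; have -> : 'D_e phi (x + s *: e) = l by case: dl.
move=> E; rewrite -lerBrDl E ler_pM2r //.
Qed.

Lemma chart_closure_le0 (x : 'rV[R]_N) :
  ball x0 r x -> closure Omega x -> phi x <= 0.
Proof.
move=> bx; apply: closure_le0 (chart_continuous ch bx) bx => y by0.
by move/(chart_mem ch by0).
Qed.

(** Stepping back from [z] along [- e] makes [phi] negative by [chart_growth], so points of [Omega]
    accumulate at [z]; and [z] itself is outside [Omega]. *)
Lemma chart_zero_bdry (z : 'rV[R]_N) : ball x0 r z -> phi z = 0 -> bdry Omega z.
Proof.
move=> bz pz; split; last first.
  by move=> /interior_subset/(chart_mem ch bz); rewrite pz ltxx.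
move=> B /nbhs_ballP[d /= d0 dB].
have [d' d'0 d'r] := ball_sub_ball bz.
pose s := Num.min d d' / 2.
have m0 : 0 < Num.min d d' by rewrite lt_min d0 d'0.
have s0 : 0 < s by rewrite /s; lra.
have [sd sd'] : s < d /\ s < d'.
  have : Num.min d d' <= d by rewrite ge_min lexx.
  have : Num.min d d' <= d' by rewrite ge_min lexx orbT.
  by rewrite /s; split; lra.
have nb d1 : s < d1 -> ball z d1 (z + (- s) *: e).
  by move=> h; apply: ball_step; rewrite normrN gtr0_norm.
exists (z + (- s) *: e); split; last by apply: dB; exact: nb.
have bz' : ball x0 r (z + (- s) *: e) by apply: d'r; exact: nb.
apply/(chart_mem ch bz').
have := @chart_growth (z + (- s) *: e) s (ltW s0) bz'.
rewrite -addrA -scalerDl addNr scale0r addr0 pz => /(_ bz) h.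
have : 0 < c * s by rewrite mulr_gt0 // (chart_c_gt0 ch).
by lra.
Qed.

(** Growth at rate [c] forces [phi] to reach 0 within length [- phi x / c]. The point reached serves
    both as a barrier centre and as a witness bounding the distance to the boundary. *)
Lemma chart_hit (x : 'rV[R]_N) : Omega x -> ball x0 r x ->
  ball x0 r (x + (- phi x / c) *: e) ->
  exists s : R, [/\ 0 <= s, s <= - phi x / c, ball x0 r (x + s *: e) &
    bdry Omega (x + s *: e)].
Proof.
move=> Ox bx; set t := - phi x / c => bt.
have c0 := chart_c_gt0 ch.
have px : phi x < 0 by apply/(chart_mem ch bx).
have t0 : 0 <= t by rewrite /t divr_ge0 ?oppr_ge0 // ltW.
have bs s : 0 <= s <= t -> ball x0 r (x + s *: e) by exact: ball_convex.
pose f s := phi (x + s *: e).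
have [||s] := @IVT R f 0 t 0 t0.
- apply: continuous_in_subspaceT => s; rewrite inE /= in_itv /= => /bs/(chart_slope ch)[l dl _].
  exact: is_derive_continuous (proj1 (@is_derive_line R _ phi x e s l) dl).
- rewrite /f scale0r addr0 ge_min le_max (ltW px) /=; apply/orP; right.
  have := chart_growth t0 bx bt.
  by rewrite mulrC /t divfK ?gt_eqF // subrr.
- rewrite in_itv /= => /andP[s0 st] fs; exists s; split => //.
    by apply: bs; rewrite s0.
  by apply: chart_zero_bdry => //; apply: bs; rewrite s0.
Qed.

Lemma dist_bdry_le (x : 'rV[R]_N) (s : R) : 0 <= s ->
  bdry Omega (x + s *: e) -> dist_bdry Omega x <= s.
Proof.
move=> s0 bz; apply: ge_inf.
  by exists 0 => _ [y _ <-]; exact: sqrtr_ge0.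
exists (x + s *: e) => //.
rewrite opprD addrA subrr sub0r -scaleNr.
rewrite /enorm -/(sqnorm _) sqnormZ (chart_unit ch) mulr1 sqrrN sqrtr_sqr.
by rewrite ger0_norm.
Qed.

End Chart.

(** The boundary point [z] rules out the infimum of the empty set, whose default value is 0. *)
Lemma dist_bdry_gt0 (R : realType) (N : nat) (Omega : set 'rV[R]_N)
  (x z : 'rV[R]_N) : open Omega -> Omega x -> bdry Omega z ->
  0 < dist_bdry Omega x.
Proof.
move=> oO Ox bz.
have /nbhs_ballP[d /= d0 dO] : nbhs x Omega by exact: open_nbhs_nbhs.
apply: (lt_le_trans d0); apply: lb_le_inf; first by exists (enorm (x - z)), z.
move=> _ [y [_ nIy] <-]; rewrite leNgt; apply/negP => xy; apply: nIy.
have Oy : Omega y.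
  apply: dO; rewrite -ball_normE /=; apply: le_lt_trans xy.
  exact: normr_le_enorm.
exact: open_nbhs_nbhs.
Qed.

(** * Comparison with barriers *)

(** The restriction of the contact argument to one coordinate line: [q] and [y] stand for the
    squared distance to the centre and the matching coordinate, as in [sqnormD_evec]. The
    conclusions are [f' = 0] and [f'' <= 0] at the maximum, expanded by the chain rule. *)
Lemma touching_barrier_1d (R : realType) (U U1 P P1 psi psi1 psi2 : R -> R)
    (U2 P2 M q y d : R) : 0 < d ->
  (forall s : R, `|s| < d -> is_derive s 1 U (U1 s)) ->
  is_derive (0 : R) 1 U1 U2 ->
  (forall s : R, `|s| < d -> is_derive s 1 P (P1 s)) ->
  is_derive (0 : R) 1 P1 P2 ->
  (forall s : R, `|s| < d -> is_derive (- P s) 1 psi (psi1 (- P s)) /\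
     is_derive (- P s) 1 psi1 (psi2 (- P s))) ->
  (forall s : R, `|s| < d ->
     U s - (psi (- P s) + M * (q + (2 * y * s + s ^+ 2))) <=
     U 0 - (psi (- P 0) + M * (q + (2 * y * 0 + 0 ^+ 2)))) ->
  U1 0 = - psi1 (- P 0) * P1 0 + 2 * M * y /\
  U2 <= psi2 (- P 0) * P1 0 ^+ 2 - psi1 (- P 0) * P2 + 2 * M.
Proof.
move=> d0 dU dU1 dP dP1 dpsi fmax.
pose f s := U s - (psi (- P s) + M * (q + (2 * y * s + s ^+ 2))).
pose f1 s := U1 s - (psi1 (- P s) * - P1 s + M * (2 * y + 2 * s)).
have dquad (s : R) : is_derive s 1 (fun s => M * (q + (2 * y * s + s ^+ 2)))
    (M * (2 * y + 2 * s)).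
  have I : is_derive s 1 (fun s : R => s) 1 := @is_derive_id R R s 1.
  have H := is_deriveZ M (is_deriveD (is_derive_cst q s 1)
    (is_deriveD (is_deriveZ (2 * y) I) (is_deriveM I I))).
  by apply: is_derive_eq H _; rewrite /GRing.scale /=; ring.
have dlin (s : R) : is_derive s 1 (fun s => M * (2 * y + 2 * s)) (M * 2).
  have I : is_derive s 1 (fun s : R => s) 1 := @is_derive_id R R s 1.
  have H := is_deriveZ M (is_deriveD (is_derive_cst (2 * y) s 1) (is_deriveZ 2 I)).
  by apply: is_derive_eq H _; rewrite /GRing.scale /=; ring.
have z : `|0 : R| < d by rewrite normr0.
have df (s : R) : `|s| < d -> is_derive s 1 f (f1 s).
  move=> sd.
  have H1 := @is_derive1_comp R psi (- P) s _ _ (dpsi s sd).1 (is_deriveN (dP s sd)).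
  exact: is_deriveB (dU s sd) (is_deriveD H1 (dquad s)).
have df1 : is_derive (0 : R) 1 f1
    (U2 - ((psi2 (- P 0) * - P1 0 * - P1 0 + psi1 (- P 0) * - P2) + M * 2)).
  have H1 := @is_derive1_comp R psi1 (- P) 0 _ _ (dpsi 0 z).2 (is_deriveN (dP 0 z)).
  have H2 := is_deriveM H1 (is_deriveN dP1).
  have H3 := is_deriveB dU1 (is_deriveD H2 (dlin 0)).
  apply: is_derive_eq H3 _.
  by rewrite !fctE /GRing.scale /=; ring.
have [E L] := second_derivative_test d0 df df1 fmax.
by split; [move: E; rewrite /f1 | ]; lra.
Qed.

Lemma sqnorm_continuous (R : realType) (N : nat) (z : 'rV[R]_N) :
  continuous (fun x : 'rV[R]_N => sqnorm (x - z)).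
Proof.
move=> x.
have c1 (i : 'I_N) : {for x, continuous (fun y : 'rV[R]_N => (y - z) 0 i ^+ 2)}.
  have -> : (fun y : 'rV[R]_N => (y - z) 0 i ^+ 2) = (fun y : 'rV[R]_N => (y 0 i - z 0 i) ^+ 2).
    by apply/funext => y; rewrite !mxE.
  have c1 : {for x, continuous (fun y : 'rV[R]_N => y 0 i - z 0 i)}.
    exact: (cvgB (@coord_continuous R 1 N 0 i x) (cvg_cst (z 0 i))).
  exact: (cvgM c1 c1).
have cs l : {for x, continuous
    (fun y : 'rV[R]_N => \sum_(i <- l) (y - z) 0 i ^+ 2)}.
  elim: l => [|i l IH].
    have -> : (fun y : 'rV[R]_N => \sum_(i <- [::]) (y - z) 0 i ^+ 2) = cst 0.
      by apply/funext => y; rewrite big_nil.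
    exact: cst_continuous.
  have -> : (fun y : 'rV[R]_N => \sum_(j <- i :: l) (y - z) 0 j ^+ 2) =
      (fun y => (y - z) 0 i ^+ 2) + (fun y => \sum_(j <- l) (y - z) 0 j ^+ 2).
    by apply/funext => y; rewrite big_cons.
  exact: (continuousD (c1 i) IH).
exact: cs.
Qed.

Section Comparison.
Variables (R : realType) (N : nat) (Omega : set 'rV[R]_N).
Variables (phi : 'rV[R]_N -> R) (x0 e : 'rV[R]_N) (r c K : R).
Hypothesis ch : chart Omega phi x0 e r c K.
Variables (u F : 'rV[R]_N -> R) (C : R).
Hypothesis C0 : 0 <= C.
Hypothesis oO : open Omega.
Hypothesis u2 : Ck_on 2 Omega u.
Hypothesis uc : {within closure Omega, continuous u}.
Hypothesis u0 : forall x, bdry Omega x -> u x = 0.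
Hypothesis uF : forall x, Omega x ->
  F x <= laplacian u x + C * grad_norm2 u x.
Variables (z : 'rV[R]_N) (rho : R).
Hypothesis rho0 : 0 < rho.
Hypothesis zrho : forall x, `|z - x| <= rho -> ball x0 r x.
Variables (psi psi1 psi2 : R -> R) (delta eta M m S : R).
Hypothesis eta0 : 0 < eta.
Hypothesis M0 : 0 <= M.
Hypothesis dpsi : forall t : R, - eta < t < delta + eta ->
  is_derive t 1 psi (psi1 t) /\ is_derive t 1 psi1 (psi2 t).
Hypothesis psi0 : 0 <= psi 0.
Hypothesis psim : forall t, 0 <= t <= delta -> - m <= psi t.
Hypothesis uS : forall x, Omega x -> `|z - x| <= rho -> - phi x <= delta ->
  u x <= S.
Hypothesis Spsi : S <= psi delta.
Hypothesis SM : S + m <= M * rho ^+ 2.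
(** The left side dominates the Laplacian plus [C] times the squared gradient of the barrier:
    [N%:R * K] bounds the Laplacian of [phi], [2 * N%:R * M] is that of the quadratic term, and the
    gradient is split by [(a + b)^2 <= 2 a^2 + 2 b^2]. Strictness lets a mere contact be
    contradictory. *)
Hypothesis barrier : forall x, Omega x -> `|z - x| < rho -> - phi x < delta ->
  psi2 (- phi x) * grad_norm2 phi x + 2 * C * psi1 (- phi x) ^+ 2 * grad_norm2 phi x
  + `|psi1 (- phi x)| * (N%:R * K)
  + (2 * N%:R * M + 8 * C * M ^+ 2 * (N%:R * rho ^+ 2)) < F x.

Let W x := psi (- phi x) + M * sqnorm (x - z).
Let G := [set x | [/\ closure Omega x, `|z - x| <= rho & - phi x <= delta]].

(** Continuity of [phi] is known only in the chart, so a limit point is first placed in the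
    [rho]-ball; only then does the condition on [phi] pass to the limit. *)
Let G_compact : compact G.
Proof.
apply: bounded_closed_compact.
  exists (`|z| + rho); split; first exact: num_real.
  move=> B hB x [_ zx _]; apply: le_trans (ltW hB).
  have -> : x = z - (z - x) by rewrite opprB addrC subrK.
  by apply: le_trans (ler_normB _ _) _; rewrite lerD2l.
move=> x cx.
have cOx : closure Omega x.
  by apply: (@closed_closure _ Omega); apply: closure_subset cx => y [].
have zx : `|z - x| <= rho.
  have cb := @closed_closed_ball_ R 'rV[R]_N z rho.
  by apply: cb; apply: closure_subset cx => y [].
split => //; rewrite leNgt; apply/negP => px.
have bx := zrho zx.
have cphi : phi y @[y --> x] --> phi x := chart_continuous ch bx.
have np : \forall y \near x, delta < - phi y.
  have px' : phi x < - delta by rewrite ltrNr.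
  have : nbhs x (phi @^-1` [set y | y < - delta]).
    by apply: (cphi [set y | y < - delta]); apply: lt_nbhsl.
  by apply: filterS => y /=; rewrite ltrNr.
have [y [[_ _ py]]] := cx _ np.
by rewrite /= ltNge py.
Qed.

Let G_phi x : G x -> 0 <= - phi x <= delta.
Proof.
move=> [cx zx px]; rewrite px andbT oppr_ge0.
exact: (chart_closure_le0 ch (zrho zx) cx).
Qed.

Let uW_continuous : {within G, continuous (u - W)}.
Proof.
have cu : {within G, continuous u} by apply: continuous_subspaceW uc => y [].
have cW : {within G, continuous W}.
  apply: continuous_in_subspaceT => x; rewrite inE => Gx.
  have [_ zx _] := Gx.
  have cphi : {for x, continuous phi} := chart_continuous ch (zrho zx).
  have c1 : {for x, continuous (fun y : 'rV[R]_N => psi (- phi y))}.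
    apply: (@continuous_comp _ _ _ (fun y => - phi y) psi).
      exact: continuousN.
    apply: (@is_derive_continuous _ _ _ (psi1 (- phi x))).
    apply: (dpsi _).1; have /andP[p0 p1] := G_phi Gx; move: eta0; lra.
  have c2 : {for x, continuous (fun y : 'rV[R]_N => M * sqnorm (y - z))}.
    have c3 : {for x, continuous (cst M : 'rV[R]_N -> R)} by exact: cst_continuous.
    exact: (continuousM c3 (@sqnorm_continuous R N z x)).
  exact: (continuousD c1 c2).
move=> x; have := @continuousB R R (subspace G) u W x (cu x) (cW x). apply.
Qed.

(** At an interior maximum of [u - W] the gradients agree and each pure second derivative of [u] is
    at most that of [W]. Summing over the coordinates gives
    [laplacian u y + C * grad_norm2 u y < F y], against [uF]. *)
Let contact (y : 'rV[R]_N) : Omega y -> `|z - y| < rho -> - phi y < delta ->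
  (forall x, G x -> u x - W x <= u y - W y) -> False.
Proof.
move=> Oy zy py ymax.
have by0 := zrho (ltW zy).
have phiy : phi y < 0 by apply/(chart_mem ch by0).
have [d d0 dsub] : exists2 d : R, 0 < d & forall x, `|y - x| < d ->
    [/\ Omega x, `|z - x| < rho & - phi x < delta].
  have n1 : nbhs y Omega by exact: open_nbhs_nbhs.
  have n2 : nbhs y [set x | `|z - x| < rho].
    have [d d0 dsub] : exists2 d : R, 0 < d & ball y d `<=` ball z rho.
      by apply: ball_sub_ball; rewrite -ball_normE.
    by apply/nbhs_ballP; exists d => // x /dsub; rewrite -ball_normE.
  have cphi : phi x @[x --> y] --> phi y := chart_continuous ch by0.
  have n3 : nbhs y (phi @^-1` [set t | - delta < t]).
    by apply: (cphi [set t | - delta < t]); apply: lt_nbhsr; rewrite ltrNl.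
  have [d /= d0 H] := proj1 (nbhs_ballP y _) (filterI n1 (filterI n2 n3)).
  exists d => // x yx; have [|h1 [h2 h3]] := H x; first by rewrite -ball_normE.
  by split => //; rewrite ltrNl.
have line i (s : R) : `|s| < d -> `|y - (y + s *: evec R i)| < d.
  move=> sd; rewrite opprD addrA subrr sub0r normrN.
  by apply: le_lt_trans sd; exact: normrZ_unit_le (sqnorm_evec _ _).
have test i : partial i u y = - psi1 (- phi y) * partial i phi y + 2 * M * (y - z) 0 i /\
    partial i (partial i u) y <= psi2 (- phi y) * partial i phi y ^+ 2
       - psi1 (- phi y) * partial i (partial i phi) y + 2 * M.
  have E0 (f : 'rV[R]_N -> R) : f y = f (y + 0 *: evec R i).
    by rewrite scale0r addr0.
  rewrite (E0 (partial i u)) (E0 (partial i phi)) (E0 phi).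
  apply: (@touching_barrier_1d R (fun s => u (y + s *: evec R i))
    (fun s => partial i u (y + s *: evec R i))
    (fun s => phi (y + s *: evec R i))
    (fun s => partial i phi (y + s *: evec R i)) psi psi1 psi2 _ _ M
    (sqnorm (y - z)) ((y - z) 0 i) d d0).
  - move=> s /line - /(_ i)/dsub[Os _ _].
    apply: (proj1 (@is_derive_line R _ u _ _ s _)).
    by apply: derivableP; apply: (u2.1 [::]).
  - apply: (proj1 (@is_derive_line R _ (partial i u) _ _ 0 _)).
    rewrite scale0r addr0.
    by apply: derivableP; apply: (u2.1 [:: i]).
  - move=> s /line - /(_ i)/dsub[_ /ltW/zrho bs _].
    apply: (proj1 (@is_derive_line R _ phi _ _ s _)).
    exact/derivableP/(chart_derivable ch).
  - apply: (proj1 (@is_derive_line R _ (partial i phi) _ _ 0 _)).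
    rewrite scale0r addr0.
    exact/derivableP/(chart_derivable2 ch).
  - move=> s /line - /(_ i)/dsub[Os /ltW/zrho bs ps].
    apply: dpsi; have /(chart_mem ch bs) := Os; move: eta0; lra.
  - move=> s /line - /(_ i)/dsub[Os zs ps].
    rewrite -!sqnormD_evec !scale0r !addr0 [y - z + _]addrAC; apply: ymax.
    by split; [exact: subset_closure | exact: ltW | exact: ltW].
pose t := - phi y.
pose a i := partial i phi y; pose b i := partial i (partial i phi) y.
have lapu : laplacian u y <= psi2 t * grad_norm2 phi y - psi1 t * laplacian phi y
    + 2 * N%:R * M.
  have -> : psi2 t * grad_norm2 phi y - psi1 t * laplacian phi y + 2 * N%:R * M =
      \sum_i (psi2 t * a i ^+ 2 - psi1 t * b i + 2 * M).
    rewrite !big_split /= sumrN -!mulr_sumr; congr (_ + _).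
    by rewrite sumr_const card_ord -mulr_natl; ring.
  by apply: ler_sum => i _; exact: (test i).2.
have gradu : grad_norm2 u y <= 2 * psi1 t ^+ 2 * grad_norm2 phi y +
    8 * M ^+ 2 * sqnorm (y - z).
  rewrite /grad_norm2 /sqnorm !mulr_sumr -big_split /=.
  apply: ler_sum => i _; rewrite (test i).1 -/t -/(a i).
  rewrite -subr_ge0; have -> : 2 * psi1 t ^+ 2 * a i ^+ 2 + 8 * M ^+ 2 * (y - z) 0 i ^+ 2
    - (- psi1 t * a i + 2 * M * (y - z) 0 i) ^+ 2 =
    (psi1 t * a i + 2 * M * (y - z) 0 i) ^+ 2 by ring.
  exact: sqr_ge0.
have lapphi : - psi1 t * laplacian phi y <= `|psi1 t| * (N%:R * K).
  apply: le_trans (ler_norm _) _; rewrite normrM normrN ler_wpM2l //.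
  apply: le_trans (ler_norm_sum _ _ _) _.
  rewrite -[N in N%:R]card_ord mulr_natl -sumr_const.
  by apply: ler_sum => i _; apply: (chart_bound2 ch).
have sq : sqnorm (y - z) <= N%:R * rho ^+ 2.
  apply: le_trans (sqnorm_le _) _; rewrite ler_wpM2l //.
  rewrite ler_pXn2r // ?nnegrE //; last exact: ltW.
  by rewrite -normrN opprB ltW.
have M2 : 0 <= 8 * M ^+ 2 by rewrite mulr_ge0 // sqr_ge0.
have h1 := ler_wpM2l C0 gradu.
have h2 : C * (8 * M ^+ 2 * sqnorm (y - z)) <= C * (8 * M ^+ 2 * (N%:R * rho ^+ 2)).
  by rewrite ler_wpM2l // ler_wpM2l.
have := barrier Oy zy py; have := uF Oy; rewrite -/t => h3 h4.
move: h1; rewrite mulrDr => h1.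
have : F y < F y.
  apply: le_lt_trans h3 (le_lt_trans _ h4).
  apply: le_trans (lerD lapu h1) _; rewrite -subr_ge0.
  rewrite [X in 0 <= X](_ : _ =
    (`|psi1 t| * (N%:R * K) - - psi1 t * laplacian phi y) +
    (C * (8 * M ^+ 2 * (N%:R * rho ^+ 2)) - C * (8 * M ^+ 2 * sqnorm (y - z)))).
    by rewrite addr_ge0 // subr_ge0.
  by ring.
by rewrite ltxx.
Qed.

(** A positive maximum of [u - W] on the compact [G] has nowhere to lie: [psi0] excludes the
    boundary of [Omega], [SM] the lateral face [|z - y| = rho], [Spsi] the face [- phi y = delta],
    and [contact] the remaining points. *)
Lemma comparison (x : 'rV[R]_N) : Omega x -> `|z - x| <= rho ->
  - phi x <= delta -> u x <= psi (- phi x) + M * sqnorm (x - z).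
Proof.
move=> Ox zx px; rewrite -/(W x) leNgt; apply/negP => ux.
have Gx : G x by split => //; exact: subset_closure.
have [|||y] := @EVT_max_rV R N (u - W) G.
- by exists x.
- exact: G_compact.
- exact: uW_continuous.
rewrite inE => Gy ymax'.
have ymax t : G t -> u t - W t <= u y - W y.
  by move=> Gt; apply: ymax'; rewrite inE.
have wy : 0 < u y - W y by apply: lt_le_trans (ymax x Gx); rewrite subr_gt0.
have [cy zy py] := Gy.
have sq0 := sqnorm_ge0 (y - z).
have Oy : Omega y.
  apply: contrapT => nOy.
  have by0 : bdry Omega y by split => // /interior_subset.
  have phiy : phi y = 0.
    apply/eqP; rewrite eq_le (chart_closure_le0 ch (zrho zy) cy) /= leNgt.
    by apply/negP => /(chart_mem ch (zrho zy)).
  move: wy; rewrite u0 // /W phiy oppr0.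
  have : 0 <= M * sqnorm (y - z) by rewrite mulr_ge0.
  by move: psi0; lra.
have yS := uS Oy zy py.
apply: (contact Oy) => //.
- rewrite lt_neqAle zy andbT; apply/eqP => E.
  have h1 : M * rho ^+ 2 <= M * sqnorm (y - z).
    by rewrite ler_wpM2l // -E -normrN opprB sqr_normr_le_sqnorm.
  have := psim (G_phi Gy); move: wy SM yS h1; rewrite /W; lra.
- rewrite lt_neqAle py andbT; apply/eqP => E.
  have : 0 <= M * sqnorm (y - z) by rewrite mulr_ge0.
  move: wy yS Spsi; rewrite /W E; lra.
Qed.

End Comparison.

(** * Existence of boundary charts *)

(** The profile is [lam^-1 * ln (1 + t / eps)]. The linear upper bound is [ln (1 + x) <= x]; the
    lower bound on the slope comes from [eps <= delta]. *)
Lemma log_profile (R : realType) (lam delta S : R) :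
  0 < lam -> 0 < delta -> 0 <= S ->
  exists eps (psi psi1 psi2 : R -> R),
    [/\ 0 < eps,
        forall t : R, - eps < t ->
          is_derive t 1 psi (psi1 t) /\ is_derive t 1 psi1 (psi2 t),
        psi 0 = 0, S <= psi delta &
        forall t, 0 <= t <= delta ->
          [/\ 0 <= psi t <= t / (lam * eps), psi2 t = - lam * psi1 t ^+ 2 &
              (2 * lam * delta)^-1 <= psi1 t]].
Proof.
move=> l0 d0 S0.
(* This choice gives [delta / eps = expR (lam * S)], hence [psi delta >= S] however small [delta]
   is. *)
pose eps := delta * expR (- (lam * S)).
have e0 : 0 < eps by rewrite mulr_gt0 // expR_gt0.
have ed : eps <= delta.
  by rewrite ger_pMr // -expR0 ler_expR oppr_le0 mulr_ge0 // ltW.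
pose psi t := lam^-1 * (ln (eps + t) - ln eps).
pose psi1 t := lam^-1 * (eps + t)^-1.
pose psi2 t := lam^-1 * - (eps + t) ^- 2.
exists eps, psi, psi1, psi2.
have shift_derive (t : R) : is_derive t 1 (fun s : R => eps + s) 1.
  have H := is_deriveD (is_derive_cst eps t 1) (is_derive_id t 1).
  by apply: is_derive_eq H _; rewrite add0r.
have psi_ln t : 0 <= t -> psi t = lam^-1 * ln (1 + t / eps).
  move=> t0; rewrite /psi; congr (_ * _).
  have -> : eps + t = eps * (1 + t / eps).
    by rewrite mulrDr mulr1 mulrCA divff ?mulr1 // gt_eqF.
  rewrite lnM ?posrE //; last by rewrite ltr_pwDl // divr_ge0 // ltW.
  by rewrite addrAC subrr add0r.
split; first exact: e0.
- move=> t et; have p : 0 < eps + t by lra.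
  split.
  + have H1 := @is_derive1_comp R (@ln R) (fun s => eps + s) t _ _
      (is_derive1_ln p) (shift_derive t).
    have H2 := is_deriveZ lam^-1 (is_deriveB H1 (is_derive_cst (ln eps) t 1)).
    by apply: is_derive_eq H2 _; rewrite mulr1 subr0.
  + have H1 : is_derive t 1 (fun s => (eps + s)^-1) (- (eps + t) ^- 2).
      have [h1 h2] := shift_derive t.
      apply: DeriveDef; first by apply: derivableV h1; rewrite gt_eqF.
      by rewrite deriveV ?gt_eqF // h2 [LHS]mulr1.
    exact: (is_deriveZ lam^-1 H1).
- by rewrite /psi addr0 subrr mulr0.
- rewrite psi_ln ?(ltW d0) // ler_pdivlMl //.
  rewrite -(expRK (lam * S)) ler_ln ?posrE ?expR_gt0 //; last first.
    by rewrite ltr_pwDl // divr_ge0 // ltW.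
  have -> : delta / eps = expR (lam * S).
    by rewrite /eps invfM expRN invrK mulrA divff ?mul1r // gt_eqF.
  by rewrite lerDr.
- move=> t /andP[t0 td]; have p : 0 < eps + t by lra.
  have q0 : 0 <= t / eps by rewrite divr_ge0 // ltW.
  split.
  + rewrite psi_ln //; apply/andP; split.
      by rewrite mulr_ge0 ?invr_ge0 ?(ltW l0) // ln_ge0 // lerDl.
    have -> : t / (lam * eps) = lam^-1 * (t / eps).
      by field; rewrite !gt_eqF.
    rewrite ler_pM2l ?invr_gt0 //.
    by apply: le_ln1Dx; lra.
  + by rewrite /psi2 /psi1; field; rewrite !gt_eqF.
  + rewrite /psi1 -invfM lef_pV2 ?posrE ?mulr_gt0 //.
    have -> : 2 * lam * delta = lam * (2 * delta) by ring.
    by rewrite ler_pM2l //; lra.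
Qed.

Lemma compact_closure_domain (R : realType) (N : nat) (Omega : set 'rV[R]_N)
  (M : R) : (forall x, Omega x -> enorm x <= M) -> compact (closure Omega).
Proof.
move=> OM; apply: bounded_closed_compact; last exact: closed_closure.
exists M; split; first exact: num_real.
move=> B hB x cx; apply: le_trans (ltW hB).
have cb := @closed_closed_ball_ R 'rV[R]_N 0 M.
have : `|0 - x| <= M.
  apply: cb; apply: closure_subset cx => y Oy.
  rewrite /closed_ball_ /= sub0r normrN.
  by apply: le_trans (OM _ Oy); exact: normr_le_enorm.
by rewrite sub0r normrN.
Qed.

(** A point of the closure maximising one coordinate is on the boundary: from a point of the open
    set [Omega], a small step along that axis would increase the coordinate. *)
Lemma bdry_nonempty (R : realType) (N : nat) (Omega : set 'rV[R]_N) (M : R) :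
  (0 < N)%N -> open Omega -> Omega !=set0 ->
  (forall x, Omega x -> enorm x <= M) -> bdry Omega !=set0.
Proof.
move=> N0 oO [a Oa] OM; pose i : 'I_N := Ordinal N0.
have cO := compact_closure_domain OM.
have [|||z] := @EVT_max_rV R N (fun x => x 0 i) (closure Omega).
- by exists a; exact: subset_closure.
- exact: cO.
- by apply: continuous_subspaceT => x; exact: (@coord_continuous R 1 N 0 i x).
rewrite inE => cz zmax; exists z; split => // /interior_subset Oz.
have [d /= d0 dO] := proj1 (nbhs_ballP z _) (open_nbhs_nbhs (conj oO Oz)).
have Oz' : Omega (z + (d / 2) *: evec R i).
  apply: dO; rewrite -ball_normE /ball_ /= opprD addrA subrr sub0r normrN.
  apply: le_lt_trans (normrZ_unit_le _ (sqnorm_evec _ _)) _.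
  by rewrite gtr0_norm; lra.
have := zmax (z + (d / 2) *: evec R i).
rewrite inE => /(_ (subset_closure Oz')).
by rewrite !mxE !eqxx /= mulr1; lra.
Qed.

(** The direction [e] is a signed coordinate vector rather than the normal: [smooth_on] speaks of
    partial derivatives, and along an axis the slope is a single one of them. Continuity at [x0]
    keeps all derivatives within [c] of their values there, whence the choice of [c] as half of a
    nonzero partial and the summand [c] in [K]. *)
Lemma exists_chart (R : realType) (N : nat) (Omega : set 'rV[R]_N) :
  (0 < N)%N -> smooth_bounded_domain Omega ->
  exists x0 phi e r c K, chart Omega phi x0 e r c K /\ phi x0 = 0.
Proof.
move=> N0 [neO oO _ [M OM] smooth].
have [x0 bx0] := bdry_nonempty N0 oO neO OM.
have [r0 [phi [r00 [sphi [Ophi gphi]]]]] := smooth x0 bx0.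
have b0 : ball x0 r0 x0 by exact: ballxx.
have phi2 := sphi 2%N.
have phix0 : phi x0 = 0.
  apply/eqP; rewrite eq_le; apply/andP; split.
    apply: closure_le0 (phi2.2 [::] x0 isT b0) b0 bx0.1 => y by0.
    by move/(Ophi _ by0).
  rewrite leNgt; apply/negP => /(Ophi _ b0) Ox0.
  by apply: bx0.2; exact: open_nbhs_nbhs.
have [j gj] := gphi x0 b0 phix0.
pose c := `|partial j phi x0| / 2.
have c0 : 0 < c by rewrite divr_gt0 // normr_gt0.
pose K := \sum_i (`|partial i phi x0| + `|partial i (partial i phi) x0|) + c.
have near_part (f : 'rV[R]_N -> R) : {for x0, continuous f} ->
    \forall y \near x0, `|f y - f x0| < c :> R.
  move=> cf; have /cvgrPdist_lt/(_ c c0) : f y @[y --> x0] --> f x0 by exact: cf.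
  by apply: filterS => y; rewrite distrC.
have near_all : \forall y \near x0, forall i,
    `|partial i phi y - partial i phi x0| < c /\
    `|partial i (partial i phi) y - partial i (partial i phi) x0| < c.
  apply: (@filter_forall _ _ (fun i => [set y |
    `|partial i phi y - partial i phi x0| < c /\
    `|partial i (partial i phi) y - partial i (partial i phi) x0| < c]) (nbhs x0)) => i.
  have n1 := near_part (partial i phi) (phi2.2 [:: i] x0 isT b0).
  have n2 := near_part (partial i (partial i phi)) (phi2.2 [:: i; i] x0 isT b0).
  exact: filterI n1 n2.
have n0 : \forall y \near x0, ball x0 r0 y by apply/nbhs_ballP; exists r0.
have [r /= rp H] := proj1 (nbhs_ballP x0 _) (filterI n0 near_all).
pose sg := Num.sg (partial j phi x0).
have sgn : sg * partial j phi x0 = `|partial j phi x0| by rewrite normrEsg.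
have sg2 : sg ^+ 2 = 1 by rewrite sqr_sg gj.
have le_K i : `|partial i phi x0| + `|partial i (partial i phi) x0| + c <= K.
  rewrite lerD2r (bigD1 i) //= lerDl; apply: sumr_ge0 => k _.
  by rewrite addr_ge0.
have slope y : ball x0 r y -> c <= sg * partial j phi y.
  move=> /H[_ /(_ j)[h _]].
  have -> : sg * partial j phi y =
     `|partial j phi x0| + sg * (partial j phi y - partial j phi x0).
    by rewrite mulrBr sgn; ring.
  have : `|sg * (partial j phi y - partial j phi x0)| < c.
    by rewrite normrM normr_sg gj mul1r.
  by rewrite ltr_norml => /andP[h1 _]; move: h1; rewrite /c; lra.
exists x0, phi, (sg *: evec R j), r, c, K; split => //; split => //.
- by rewrite sqnormZ sqnorm_evec mulr1.
- by move=> x /H[/Ophi].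
- by move=> x /H[bx _]; exact: (phi2.2 [::]).
- by move=> x i /H[bx _]; exact: (phi2.1 [::]).
- by move=> x i /H[bx _]; exact: (phi2.1 [:: i]).
- move=> x i /H[_ /(_ i)[h _]]; apply: le_trans (le_K i).
  rewrite -[partial i phi x](subrK (partial i phi x0)) addrC.
  apply: le_trans (ler_normD _ _) _; rewrite -addrA lerD2l.
  by apply: le_trans (ltW h) _; rewrite lerDr.
- move=> x i /H[_ /(_ i)[_ h]]; apply: le_trans (le_K i).
  rewrite -[partial i (partial i phi) x](subrK (partial i (partial i phi) x0)) addrC.
  apply: le_trans (ler_normD _ _) _; rewrite addrAC [leRHS]addrC lerD2l.
  by apply: le_trans (ltW h) _; rewrite lerDr.
- move=> x bx; exists (sg * partial j phi x); last exact: slope.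
  have [bx0' _] := H x bx.
  have H1 := derivableP (phi2.1 [::] j x isT bx0').
  have H2 : is_derive (0 : R) 1 (fun s : R => phi (x + s *: evec R j)) (partial j phi x).
    apply: (proj1 (@is_derive_line R _ phi x (evec R j) 0 _)).
    by rewrite scale0r addr0.
  have H3 : is_derive (0 : R) 1 (fun s : R => sg * s) sg.
    have H3 := is_deriveZ sg (is_derive_id (0 : R) 1).
    by apply: is_derive_eq H3 _; rewrite [LHS]mulr1.
  have H2' : is_derive (sg * 0) 1 (fun s : R => phi (x + s *: evec R j)) (partial j phi x).
    by rewrite mulr0.
  have H4 := is_derive1_comp H2' H3.
  have -> : sg * partial j phi x = partial j phi x * sg by rewrite mulrC.
  have H5 := @is_derive_line R _ phi x (sg *: evec R j) 0 (partial j phi x * sg).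
  rewrite scale0r addr0 in H5; apply: (proj2 H5).
  have -> : (fun t : R => phi (x + t *: (sg *: evec R j))) =
      (fun s : R => phi (x + s *: evec R j)) \o (fun s : R => sg * s).
    by apply/funext => s /=; rewrite scalerA mulrC.
  exact: H4.
- move=> x bx; have h := slope x bx.
  apply: (@le_trans _ _ ((sg * partial j phi x) ^+ 2)).
    by rewrite ler_pXn2r ?nnegrE ?(ltW c0) // (le_trans (ltW c0)).
  rewrite exprMn sg2 mul1r /grad_norm2 (bigD1 j) //= lerDl.
  by apply: sumr_ge0 => k _; exact: sqr_ge0.
Qed.

(** * Linear growth at the boundary *)

(** With this [lam], at least [p^2 * G] survives the gradient term, and the lower bound on [p] gives
    [p^2 * a >= p * (k + b + a) >= p * k + b + a]. *)
Lemma quadratic_dominates (R : realFieldType) (a k b p lam C G : R) :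
  0 < a -> 0 <= k -> 0 <= b -> 0 <= C -> (k + b) / a + 1 <= p -> a <= G ->
  lam = 4 * C + 1 ->
  - lam * p ^+ 2 * G + 2 * C * p ^+ 2 * G + p * k + b < 0.
Proof.
move=> a0 k0 b0 C0 hp aG ->.
have q0 : 0 <= (k + b) / a by rewrite divr_ge0 ?addr_ge0 // ltW.
have p1 : 1 <= p by lra.
have h1 : k + b + a <= p * a.
  have : ((k + b) / a + 1) * a <= p * a by rewrite ler_pM2r.
  by rewrite mulrDl divfK ?gt_eqF // mul1r.
have h2 : p * (k + b + a) <= p * (p * a) by rewrite ler_pM2l //; lra.
have h3 : p ^+ 2 * a <= p ^+ 2 * G by rewrite ler_wpM2l // sqr_ge0.
have h4 : 0 <= 2 * C * (p ^+ 2 * G).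
  by rewrite !mulr_ge0 // ?sqr_ge0 //; lra.
have h5 : b <= p * b by rewrite ler_peMl.
have h6 : a <= p * a by rewrite ler_peMl // ltW.
have -> : - (4 * C + 1) * p ^+ 2 * G + 2 * C * p ^+ 2 * G + p * k + b =
  - (p ^+ 2 * G) - 2 * C * (p ^+ 2 * G) + p * k + b by ring.
move: h2; rewrite !mulrDr mulrA -expr2; lra.
Qed.

(** The barrier is centred at a boundary point [z] depending on [x], at distance at most [D / c]
    from it: then [M * |x - z|^2] is itself linear in [D], which a fixed centre would not give. Only
    the lower bound [- KF] of [F] enters. *)
Lemma linear_bound (R : realType) (N : nat) (Omega : set 'rV[R]_N)
    (phi : 'rV[R]_N -> R) (x0 e : 'rV[R]_N) (r c K : R)
    (u F : 'rV[R]_N -> R) (C S KF : R) :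
  chart Omega phi x0 e r c K -> phi x0 = 0 ->
  0 <= C -> open Omega -> Ck_on 2 Omega u ->
  {within closure Omega, continuous u} ->
  (forall x, bdry Omega x -> u x = 0) ->
  (forall x, Omega x -> F x <= laplacian u x + C * grad_norm2 u x) ->
  0 <= S -> 0 <= KF ->
  (forall x, Omega x -> u x <= S) -> (forall x, Omega x -> - KF <= F x) ->
  exists A r', [/\ 0 < A, 0 < r', r' <= r & forall x, ball x0 r' x -> Omega x ->
    u x <= A * - phi x /\ dist_bdry Omega x <= A * - phi x].
Proof.
move=> ch phix0 C0 oO u2 uc u0 uF S0 KF0 uS FK.
have r0 := chart_r_gt0 ch; have c0 := chart_c_gt0 ch.
have [rho [rho0 rhoE]] : exists rho : R, 0 < rho /\ rho = r / 4.
  by exists (r / 4); split => //; rewrite divr_gt0.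
have [M [M0 MS]] : exists M, 0 <= M /\ M * rho ^+ 2 = S.
  exists (S / rho ^+ 2); rewrite divfK ?gt_eqF ?exprn_gt0 //.
  by rewrite divr_ge0 // sqr_ge0.
pose b := 2 * N%:R * M + 8 * C * M ^+ 2 * (N%:R * rho ^+ 2) + KF.
have b0 : 0 <= b.
  have m2 := sqr_ge0 M; have rho2 := sqr_ge0 rho.
  have n2 : 0 <= 2 * N%:R * M by apply: mulr_ge0 => //; exact: mulr_ge0.
  have c8 : 0 <= 8 * C by apply: mulr_ge0.
  apply: addr_ge0 => //; apply: addr_ge0 => //.
  by apply: mulr_ge0; apply: mulr_ge0.
pose k := N%:R * `|K|.
have k0 : 0 <= k by rewrite mulr_ge0.
pose lam := 4 * C + 1.
have l0 : 0 < lam by rewrite /lam; lra.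
have a0 : 0 < c ^+ 2 by rewrite exprn_gt0.
pose P0 := (k + b) / c ^+ 2 + 1.
have P00 : 0 < P0.
  by apply: ltr_wpDl => //; apply: divr_ge0; [exact: addr_ge0 k0 b0 | exact: ltW].
(* Chosen so that the least slope granted by [log_profile] is exactly the threshold [P0] of
   [quadratic_dominates]. *)
pose delta := (2 * lam * P0)^-1.
have d0 : 0 < delta by rewrite invr_gt0 !mulr_gt0.
have dP : (2 * lam * delta)^-1 = P0.
  by rewrite /delta; field; rewrite !gt_eqF.
have [eps [psi [psi1 [psi2 [e0 dpsi psi0 psid H]]]]] := log_profile l0 d0 S0.
have x0b : ball x0 r x0 by exact: ballxx.
have cphi : phi y @[y --> x0] --> phi x0 := chart_continuous ch x0b.
(* Having [D < mu] puts [x] below the height [delta] and the boundary hit within [r / 8] of [x]. As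
   [r' <= r / 8], the centre lies within [r / 4] of [x0] and its [rho]-ball stays in the chart. *)
pose mu := Num.min delta (c * (r / 8)).
have mu0 : 0 < mu by rewrite lt_min d0 !mulr_gt0.
have mud : mu <= delta by rewrite ge_min lexx.
have muc : mu <= c * (r / 8) by rewrite ge_min lexx orbT.
have nphi : nbhs x0 (phi @^-1` [set t | - mu < t]).
  by apply: (cphi [set t | - mu < t]); apply: lt_nbhsr; rewrite phix0 oppr_lt0.
have [r1 /= r10 r1H] := proj1 (nbhs_ballP x0 _) nphi.
pose r' := Num.min r1 (r / 8).
have r'0 : 0 < r' by rewrite lt_min r10 divr_gt0.
have r'1 : r' <= r1 by rewrite ge_min lexx.
have r'8 : r' <= r / 8 by rewrite ge_min lexx orbT.
have le0 : 0 < (lam * eps)^-1 by rewrite invr_gt0 mulr_gt0.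
have Mc : 0 <= M * (c^-1 * (r / 8)) by rewrite !mulr_ge0 ?invr_ge0 // ltW // divr_gt0.
have ci : 0 < c^-1 by rewrite invr_gt0.
(* The summands pay for the logarithmic profile, for the quadratic term, and for the distance to the
   boundary. *)
pose A := (lam * eps)^-1 + M * (c^-1 * (r / 8)) + c^-1.
exists A, r'; split.
- by rewrite /A ltr_wpDl // addr_ge0 // ltW.
- by [].
- by lra.
move=> x bx Ox.
have bxn : `|x0 - x| < r / 8 by move: bx; rewrite -ball_normE /ball_ /=; lra.
have br y : `|x0 - y| < r -> ball x0 r y by rewrite -ball_normE.
have bxr : ball x0 r x by apply: br; lra.
pose D := - phi x; have D0 : 0 < D by rewrite oppr_gt0; apply/(chart_mem ch bxr).
have Dmu : D < mu.
  rewrite ltrNl; apply: r1H; move: bx; rewrite -!ball_normE /ball_ /= => h.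
  exact: lt_le_trans h r'1.
have Dc : D / c < r / 8 by rewrite ltr_pdivrMr // mulrC; apply: lt_le_trans muc.
have Dc0 : 0 <= D / c by rewrite divr_ge0 // ltW.
have step s : 0 <= s -> s <= D / c -> `|x0 - (x + s *: e)| < r / 4.
  move=> s0 sD; rewrite opprD addrA.
  apply: le_lt_trans (ler_normB _ _) _.
  have := normrZ_unit_le s (chart_unit ch); rewrite (ger0_norm s0); lra.
have [|s [s0 sD bz bdz]] := chart_hit ch Ox bxr.
  by apply: br; apply: lt_le_trans (step _ Dc0 (lexx _)) _; lra.
set z := x + s *: e in bz bdz.
have zx : `|z - x| <= s.
  rewrite /z addrAC subrr add0r -[leRHS]ger0_norm //.
  exact: normrZ_unit_le (chart_unit ch).
have zrho y : `|z - y| <= rho -> ball x0 r y.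
  move=> zy; apply: br.
  have -> : x0 - y = (x0 - z) + (z - y) by rewrite addrA subrK.
  apply: le_lt_trans (ler_normD _ _) _.
  have := step s s0 sD; rewrite -/z; move: zy; rewrite rhoE; lra.
have Dd : D <= delta by lra.
have cmp : u x <= psi D + M * sqnorm (x - z).
  apply: (@comparison R N Omega phi x0 e r c K ch u F C C0 oO u2 uc u0 uF z rho
     rho0 zrho psi psi1 psi2 delta eps M 0 S e0 M0) => //.
  - by move=> t /andP[t0 _]; apply: dpsi.
  - by rewrite psi0.
  - by move=> t /H[/andP[h _] _ _]; rewrite oppr0.
  - by move=> y Oy _ _; exact: uS.
  - by rewrite addr0 MS.
  - move=> y Oy zy py.
    have by0 := zrho y (ltW zy).
    have [|_ -> p1] := H (- phi y).
      by rewrite (ltW py) andbT oppr_ge0; apply/ltW/(chart_mem ch by0).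
    rewrite dP in p1.
    have p1' : 0 <= psi1 (- phi y) by apply: le_trans p1; exact: ltW.
    apply: lt_le_trans (FK y Oy).
    have := quadratic_dominates a0 k0 b0 C0 p1 (chart_grad ch by0) erefl.
    rewrite -/lam (ger0_norm p1') => q.
    have : psi1 (- phi y) * (N%:R * K) <= psi1 (- phi y) * k.
      by rewrite ler_wpM2l // ler_wpM2l // ler_norm.
    move: q; rewrite /b.
    set X := psi1 _ * (_ * K); set Y := psi1 _ * k.
    set Z1 := _ * grad_norm2 _ _; set Z2 := _ * grad_norm2 _ _.
    set Z3 := 8 * C * _ * _; set Z4 := 2 * _ * M.
    move: X Y Z1 Z2 Z3 Z4 => X Y Z1 Z2 Z3 Z4; lra.
  - apply: le_trans zx (le_trans sD _).
    by rewrite rhoE; apply: ltW; apply: lt_trans Dc _; lra.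
have xz : sqnorm (x - z) = s ^+ 2.
  by rewrite /z opprD addrA subrr sub0r -scaleNr sqnormZ (chart_unit ch) mulr1 sqrrN.
have s2 : M * s ^+ 2 <= M * (c^-1 * (r / 8)) * D.
  have -> : M * (c^-1 * (r / 8)) * D = M * (D / c * (r / 8)) by ring.
  rewrite ler_wpM2l // expr2; apply: ler_pM => //.
  exact: le_trans sD (ltW Dc).
have psiD : psi D <= (lam * eps)^-1 * D.
  have [|/andP[_ h] _ _] := H D; first by rewrite (ltW D0).
  by rewrite mulrC.
have cD : 0 <= c^-1 * D by rewrite mulr_ge0 // ltW.
have AD : A * - phi x =
    ((lam * eps)^-1 * D + M * (c^-1 * (r / 8)) * D) + c^-1 * D.
  by rewrite /A -/D !mulrDl.
split; rewrite AD.
  apply: le_trans cmp _; rewrite xz; apply: le_trans (lerD psiD s2) _.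
  by rewrite lerDl.
apply: le_trans (dist_bdry_le ch s0 bdz) _; apply: le_trans sD _.
rewrite [D / c]mulrC lerDr; apply: addr_ge0; apply: mulr_ge0 => //; exact: ltW.
Qed.

(** * Nonexistence *)

Lemma chart_shrink (R : realType) (N : nat) (Omega : set 'rV[R]_N)
    (phi : 'rV[R]_N -> R) (x0 e : 'rV[R]_N) (r r' c K : R) :
  0 < r' -> r' <= r -> chart Omega phi x0 e r c K -> chart Omega phi x0 e r' c K.
Proof.
move=> r'0 r'r [? ? ? h1 h2 h3 h4 h5 h6 h7 h8].
have sub x : ball x0 r' x -> ball x0 r x by exact: le_ball.
split => //.
- by move=> x /sub/h1.
- by move=> x /sub/h2.
- by move=> x i /sub/h3.
- by move=> x i /sub/h4.
- by move=> x i /sub/h5.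
- by move=> x i /sub/h6.
- by move=> x /sub/h7.
- by move=> x /sub/h8.
Qed.

Lemma loc_holder_pos_continuous (R : realType) (p : R -> R) (t : R) :
  loc_holder_pos p -> 0 < t -> {for t, continuous p}.
Proof.
move=> hp t0; have [||al [L [a0 _ L0 H]]] := hp (t / 2) (2 * t).
- by lra.
- by lra.
suff : p s @[s --> t] --> p t by [].
apply/cvgrPdist_le => eps e0.
have q0 : 0 < eps / (L + 1) by rewrite divr_gt0 // ltr_wpDl.
pose d := Num.min (t / 2) ((eps / (L + 1)) `^ al^-1).
have d0 : 0 < d by rewrite lt_min powR_gt0 // andbT; lra.
have dt : d <= t / 2 by rewrite ge_min lexx.
have de : d <= (eps / (L + 1)) `^ al^-1 by rewrite ge_min lexx orbT.
apply/nbhs_ballP; exists d => //= s ts'.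
have {ts'}ts : `|t - s| < d := ts'.
have := ts; rewrite ltr_norml => /andP[h1 h2].
apply: (le_trans (H _ _ _ _)); try by apply/andP; split; lra.
apply: (@le_trans _ _ (L * (eps / (L + 1)))).
  rewrite ler_wpM2l //.
  have -> : eps / (L + 1) = (eps / (L + 1)) `^ al^-1 `^ al.
    by rewrite -powRrM mulVf ?gt_eqF // powRr1 // ltW.
  apply: ge0_ler_powR; rewrite ?nnegrE ?powR_ge0 ?(ltW a0) //.
  by apply: le_trans de; exact: ltW.
rewrite mulrA ler_pdivrMr ?ltr_wpDl // mulrDr mulr1 mulrC lerDl.
exact: ltW.
Qed.

(** The Hölder bound is applied between [(x, s)] and one fixed point [(x1, 0)]; [E] bounds the
    Euclidean diameter through the maximum norm. *)
Lemma loc_holder_bounded (R : realType) (N : nat) (Omega : set 'rV[R]_N)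
    (Phi : 'rV[R]_N -> R -> R) (B S : R) :
  loc_holder_closure_halfline Omega Phi -> Omega !=set0 ->
  (forall x, Omega x -> enorm x <= B) -> 0 <= S ->
  exists2 KF, 0 <= KF & forall x s, Omega x -> 0 <= s <= S -> `|Phi x s| <= KF.
Proof.
move=> hPhi [x1 Ox1] OB S0.
have [al [L [a0 _ L0 H]]] := hPhi S S0.
pose E := Num.sqrt (N%:R * (B + B) ^+ 2).
exists (`|Phi x1 0| + L * ((E + S) `^ al)).
  by rewrite addr_ge0 // mulr_ge0 // powR_ge0.
move=> x s Ox sS; have /andP[s0 s1] := sS.
rewrite -[Phi x s](subrK (Phi x1 0)) addrC.
apply: le_trans (ler_normD _ _) _; rewrite lerD2l.
apply: (le_trans (H _ _ _ _ _ _ _ _)) => //.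
- exact: subset_closure.
- exact: subset_closure.
- by rewrite lexx.
rewrite ler_wpM2l //; apply: ge0_ler_powR; first exact: ltW.
- by rewrite nnegrE addr_ge0 // sqrtr_ge0.
- by rewrite nnegrE addr_ge0 // sqrtr_ge0.
apply: lerD; last by rewrite subr0 ger0_norm.
rewrite /enorm /E; apply: ler_wsqrtr.
apply: le_trans (sqnorm_le _) _; rewrite ler_wpM2l //.
have le1 y : Omega y -> `|y| <= B.
  by move=> Oy; apply: le_trans (OB _ Oy); exact: normr_le_enorm.
have h : `|x - x1| <= B + B.
  by apply: le_trans (ler_normB _ _) _; apply: lerD; exact: le1.
by rewrite ler_pXn2r ?nnegrE // (le_trans _ h).
Qed.

Lemma grad_norm2_le (R : realType) (N : nat) (f : 'rV[R]_N -> R)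
    (x : 'rV[R]_N) (K : R) :
  (forall i, `|partial i f x| <= K) -> grad_norm2 f x <= N%:R * K ^+ 2.
Proof.
move=> fK; rewrite /grad_norm2 -[N in N%:R]card_ord mulr_natl -sumr_const.
apply: ler_sum => i _; rewrite -[leLHS]real_normK ?num_real //.
by rewrite ler_pXn2r ?nnegrE // (le_trans _ (fK i)).
Qed.

Lemma no_positive_subsolution (R : realType) (N : nat) (Omega : set 'rV[R]_N)
    (phi : 'rV[R]_N -> R) (x0 e : 'rV[R]_N) (r c K : R)
    (u F : 'rV[R]_N -> R) (h : R -> R) (C A KF : R) :
  chart Omega phi x0 e r c K -> phi x0 = 0 ->
  0 <= C -> open Omega -> Ck_on 2 Omega u ->
  {within closure Omega, continuous u} ->
  (forall x, bdry Omega x -> u x = 0) ->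
  (forall x, Omega x -> F x <= laplacian u x + C * grad_norm2 u x) ->
  0 < A -> 0 <= KF ->
  (forall x, ball x0 r x -> Omega x -> u x <= A * - phi x) ->
  (forall x, ball x0 r x -> Omega x -> h (A * - phi x) - KF <= F x) ->
  (forall t : R, 0 < t -> {for t, continuous h}) ->
  (forall t : R, 0 < t -> 0 < h t) ->
  (forall s t : R, 0 < s -> s <= t -> h t <= h s) ->
  (forall B : R, exists2 d, 0 < d & forall t, 0 < t < d -> B < h t) ->
  (\int[@lebesgue_measure R]_(t in `]0%R, 1%R]) (h t)%:E = +oo)%E ->
  ~ (forall x, Omega x -> 0 < u x).
Proof.
move=> ch phix0 C0 oO u2 uc u0 uF A0 KF0 uA FA hc h0 hd hoo hint upos.
have r0 := chart_r_gt0 ch; have c0 := chart_c_gt0 ch.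
have [rho [rho0 rhoE]] : exists rho : R, 0 < rho /\ rho = r / 2.
  by exists (r / 2); split => //; rewrite divr_gt0.
have zrho y : `|x0 - y| <= rho -> ball x0 r y.
  by rewrite -ball_normE /ball_ /= rhoE; lra.
(* [M1] is the value of [M] for [delta = 1]. It stands in for [M] in [K5], which must be fixed
   before [delta] is chosen. *)
have [M1 [M10 M1E]] : exists M1, 0 <= M1 /\ M1 * rho ^+ 2 = 2.
  exists (2 / rho ^+ 2); rewrite divfK ?gt_eqF ?exprn_gt0 //.
  by rewrite divr_ge0 // sqr_ge0.
have [G1 [G10 G1E]] : exists G1 : R, 0 <= G1 /\ G1 = N%:R * K ^+ 2.
  by exists (N%:R * K ^+ 2); split => //; apply: mulr_ge0 => //; exact: sqr_ge0.
(* The factor [A ^+ 2] comes from differentiating [psi (A * t)] twice; the bound lets the [psi2]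
   term use at most half of [h], the other half absorbing [K5 + KF]. *)
have [eps [e0 eG]] : exists eps, 0 < eps /\ eps * (A ^+ 2 * G1) <= 1 / 2.
  have a2 : 0 <= A ^+ 2 * G1 by apply: mulr_ge0 => //; exact: sqr_ge0.
  exists (2 * (A ^+ 2 * G1 + 1))^-1; split.
    by rewrite invr_gt0 mulr_gt0 // ltr_wpDl.
  rewrite mulrC ler_pdivrMr ?mulr_gt0 ?ltr_wpDl //; lra.
pose K5 := 2 * C * (9 * A ^+ 2) * G1 + 3 * A * (N%:R * `|K|) +
  (2 * N%:R * M1 + 8 * C * M1 ^+ 2 * (N%:R * rho ^+ 2)).
have [d1 d10 d1h] := hoo (2 * (K5 + KF)).
have [delta [d0 dd1 dle1]] : exists delta, [/\ 0 < delta, delta <= d1 & delta <= 1].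
  exists (Num.min d1 1); split; first by rewrite lt_min d10 ltr01.
    by rewrite ge_min lexx.
  by rewrite ge_min lexx orbT.
have [psi [psi1 [psi2 [dpsi psi0 psi10 psid H]]]] :=
  convex_profile hc h0 hd hint d0 dle1 e0.
(* On the lateral face [u] is at most [delta] and the profile at least [- delta], so the quadratic
   term has to supply [delta + delta]. *)
have [M [M0 Mrho MM1]] : exists M, [/\ 0 <= M, M * rho ^+ 2 = delta + delta & M <= M1].
  exists (delta * M1); split; first by rewrite mulr_ge0 // ltW.
    by rewrite -mulrA M1E; ring.
  by rewrite ler_piMl.
have main x : Omega x -> `|x0 - x| <= rho -> - phi x <= delta / A ->
    u x <= psi (A * - phi x) + M * sqnorm (x - x0).
  apply: (@comparison R N Omega phi x0 e r c K ch u F C C0 oO u2 uc u0 uF x0 rho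
     rho0 zrho (fun t => psi (A * t)) (fun t => A * psi1 (A * t))
     (fun t => A ^+ 2 * psi2 (A * t)) (delta / A) ((2 * A)^-1) M delta delta) => //.
  - by rewrite invr_gt0 mulr_gt0.
  - move=> t /andP[t1 t2].
    have h1 : - (1 / 2) < A * t.
      have : A * - (2 * A)^-1 < A * t by rewrite ltr_pM2l.
      by have -> : A * - (2 * A)^-1 = - (1 / 2) by field; rewrite gt_eqF.
    have h2 : A * t < 3 / 2.
      have : A * t < A * (delta / A + (2 * A)^-1) by rewrite ltr_pM2l.
      have -> : A * (delta / A + (2 * A)^-1) = delta + 1 / 2.
        by field; rewrite gt_eqF.
      by lra.
    have [|D1 D2] := dpsi (A * t); first by rewrite h1.
    have DA : is_derive t 1 (fun t : R => A * t) A.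
      have D3 := is_deriveZ A (is_derive_id t 1).
      by apply: is_derive_eq D3 _; rewrite [LHS]mulr1.
    have D3 := is_derive1_comp D1 DA; have D4 := is_derive1_comp D2 DA.
    split; first by apply: is_derive_eq D3 _; rewrite mulrC.
    have D5 := is_deriveZ A D4.
    apply: is_derive_eq D5 _.
    by rewrite -[_ *: _]/(A * (psi2 (A * t) * A)); ring.
  - by rewrite mulr0 psi0.
  - move=> t /andP[t0 td].
    have At : 0 <= A * t <= delta.
      by rewrite mulr_ge0 ?(ltW A0) //= mulrC -ler_pdivlMr.
    have [hp _ _ _] := H _ At; apply: le_trans hp.
    by rewrite lerN2; case/andP: At.
  - move=> y Oy yrho pd; apply: le_trans (uA y (zrho y yrho) Oy) _.
    by rewrite mulrC -ler_pdivlMr.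
  - by rewrite mulrC divfK // gt_eqF.
  - by rewrite Mrho.
  - move=> y Oy /ltW/zrho by0 pd.
    have pneg : 0 < - phi y by rewrite oppr_gt0; apply/(chart_mem ch by0).
    set t := A * - phi y.
    have t0 : 0 < t by rewrite mulr_gt0.
    have td : t < delta by rewrite /t mulrC -ltr_pdivlMr.
    have [|_ /andP[q1 q2] q3 /(_ t0) q4] := H t; first by rewrite !ltW.
    apply: lt_le_trans (FA y by0 Oy); rewrite -/t.
    have ht : 2 * (K5 + KF) < h t by apply: d1h; rewrite t0 (lt_le_trans td).
    have hG : grad_norm2 phi y <= G1.
      by rewrite G1E; apply: grad_norm2_le => i; exact: (chart_bound1 ch).
    have hG0 : 0 <= grad_norm2 phi y by apply: sumr_ge0 => i _; exact: sqr_ge0.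
    have b1 : A ^+ 2 * psi2 t * grad_norm2 phi y <= h t / 2.
      apply: (@le_trans _ _ (A ^+ 2 * (eps * h t) * G1)).
        apply: ler_pM => //; first by rewrite mulr_ge0 // sqr_ge0.
        by rewrite ler_wpM2l // sqr_ge0.
      have -> : A ^+ 2 * (eps * h t) * G1 = eps * (A ^+ 2 * G1) * h t by ring.
      apply: (@le_trans _ _ (1 / 2 * h t)); first by rewrite ler_wpM2r // ltW // h0.
      by lra.
    have p9 : psi1 t ^+ 2 <= 9.
      have p3 : 0 <= (3 - psi1 t) * (psi1 t + 3) by apply: mulr_ge0; lra.
      by move: p3; move: (psi1 t) => y1; lra.
    have b2 : 2 * C * (A * psi1 t) ^+ 2 * grad_norm2 phi y <=
        2 * C * (9 * A ^+ 2) * G1.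
      apply: ler_pM => //.
        by rewrite mulr_ge0 ?sqr_ge0 // mulr_ge0.
      rewrite ler_wpM2l ?mulr_ge0 // exprMn mulrC ler_wpM2r ?sqr_ge0 //.
    have b3 : `|A * psi1 t| * (N%:R * K) <= 3 * A * (N%:R * `|K|).
      apply: (@le_trans _ _ (`|A * psi1 t| * (N%:R * `|K|))).
        by rewrite ler_wpM2l // ler_wpM2l // ler_norm.
      rewrite ler_wpM2r ?mulr_ge0 // normrM (gtr0_norm A0) mulrC.
      apply: ler_wpM2r; first exact: ltW.
      by rewrite ler_norml; lra.
    have b4 : 2 * N%:R * M <= 2 * N%:R * M1 by rewrite ler_wpM2l // mulr_ge0.
    have b5 : 8 * C * M ^+ 2 * (N%:R * rho ^+ 2) <= 8 * C * M1 ^+ 2 * (N%:R * rho ^+ 2).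
      apply: ler_wpM2r; first by apply: mulr_ge0 => //; exact: sqr_ge0.
      apply: ler_wpM2l; first exact: mulr_ge0.
      by rewrite ler_pXn2r ?nnegrE.
    apply: le_lt_trans (lerD (lerD (lerD b1 b2) b3) (lerD b4 b5)) _.
    rewrite -2!addrA (addrA (2 * C * _ * _)) -/K5.
    by move: (K5) (h t) ht => k1 k2; lra.
have D1 : is_derive (0 : R) 1 psi (-1) by rewrite -psi10; apply: (dpsi 0 _).1; lra.
have [|d2 d20 psi_near] := @is_derive_near_right R psi 0 (-1) (1 / 2) D1; first by lra.
have [mu [mu0 mud mud2]] : exists mu, [/\ 0 < mu, mu <= delta & mu <= d2].
  exists (Num.min delta d2); split; first by rewrite lt_min d0 d20.
    by rewrite ge_min lexx.
  by rewrite ge_min lexx orbT.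
have x0b : ball x0 r x0 by exact: ballxx.
have cphi : phi y @[y --> x0] --> phi x0 := chart_continuous ch x0b.
have muA : 0 < mu / A by rewrite divr_gt0.
have nphi : nbhs x0 (phi @^-1` [set t | - (mu / A) < t]).
  by apply: (cphi [set t | - (mu / A) < t]); apply: lt_nbhsr; rewrite phix0 oppr_lt0.
have [r1 /= r10 r1H] := proj1 (nbhs_ballP x0 _) nphi.
(* For [s] below this bound [M * s ^+ 2 < A * (c * s) / 2], while near 0 the profile is at most
   minus half its argument, which is at least [A * (c * s)]. The [+ 1] covers [M = 0] and makes the
   inequality strict. *)
have q0 : 0 < A * c / (2 * (M + 1)) by rewrite divr_gt0 ?mulr_gt0 // ltr_wpDl.
have [s [s0 sr1 srho sq]] : exists s : R, [/\ 0 < s, s < r1, s <= rho &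
    s <= A * c / (2 * (M + 1))].
  exists (Num.min (r1 / 2) (Num.min rho (A * c / (2 * (M + 1))))); split.
  - by rewrite !lt_min rho0 q0 divr_gt0.
  - by apply: (@le_lt_trans _ _ (r1 / 2)); [rewrite ge_min lexx | lra].
  - by rewrite !ge_min lexx orbT.
  - by rewrite !ge_min lexx !orbT.
pose x := x0 + (- s) *: e.
have x0x : `|x0 - x| <= s.
  rewrite /x opprD addrA subrr sub0r normrN -[leRHS]gtr0_norm // -[leRHS]normrN.
  exact: normrZ_unit_le (chart_unit ch).
have bx : ball x0 r x by apply: zrho; apply: le_trans srho.
have phx : phi x <= - (c * s).
  have := @chart_growth _ _ _ _ _ _ _ _ _ ch x s (ltW s0) bx.
  rewrite /x -addrA -scalerDl addNr scale0r addr0 phix0 => /(_ x0b); lra.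
have cs : 0 < c * s by rewrite mulr_gt0.
have pneg : phi x < 0 by lra.
have Ox : Omega x by apply/(chart_mem ch bx).
have Dmu : - phi x < mu / A.
  by rewrite ltrNl; apply: r1H; rewrite -ball_normE /ball_ /=; apply: le_lt_trans sr1.
have tmu : A * - phi x < mu by rewrite mulrC -ltr_pdivlMr.
have ux : u x <= psi (A * - phi x) + M * sqnorm (x - x0).
  apply: main => //; first exact: le_trans srho.
  by apply: (le_trans (ltW Dmu)); rewrite ler_pM2r ?invr_gt0.
have t0 : 0 < A * - phi x by rewrite mulr_gt0 // oppr_gt0.
have := psi_near (A * - phi x); rewrite t0 (lt_le_trans tmu) // => /(_ isT).
rewrite add0r psi0 subr0 ler_norml => /andP[_ hpsi].
have sx : sqnorm (x - x0) = s ^+ 2.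
  by rewrite /x addrAC subrr add0r sqnormZ (chart_unit ch) mulr1 sqrrN.
have Acs : A * (c * s) <= A * - phi x by rewrite ler_pM2l //; lra.
have Ms : M * s ^+ 2 < A * (c * s) / 2.
  have h1 : (M + 1) * s * 2 <= A * c.
    have : s * (2 * (M + 1)) <= A * c by rewrite -ler_pdivlMr // mulr_gt0 // ltr_wpDl.
    by lra.
  have : (M + 1) * s * 2 * s <= A * c * s by rewrite ler_wpM2r // ltW.
  have : 0 < s * s by rewrite mulr_gt0.
  by rewrite expr2; lra.
have := upos x Ox; move: ux; rewrite sx.
move: hpsi Ms Acs t0; lra.
Qed.

Theorem theorem2p1 (R : realType) (N : nat) (Omega : set 'rV[R]_N)
  (g p : R -> R) (Phi : 'rV[R]_N -> R -> R) (C : R) :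
  (2 <= N)%N ->
  smooth_bounded_domain Omega ->
  (* g in C^1(0,oo), positive, decreasing, g(0+) = +oo *)
  (forall t, 0 < t -> derivable g t 1) ->
  (forall t, 0 < t -> {for t, continuous (derive1 g)}) ->
  (forall t, 0 < t -> 0 < g t) ->
  (forall s t, 0 < s -> s < t -> g t < g s) ->
  g x @[x --> 0^'+] --> +oo ->
  (* p : (0,oo) -> (0,oo), nonincreasing, Hoelder continuous *)
  (forall t, 0 < t -> 0 < p t) ->
  (forall s t, 0 < s -> s <= t -> p t <= p s) ->
  loc_holder_pos p ->
  (* int_0^1 p g = +oo *)
  (\int[@lebesgue_measure R]_(t in `]0%R, 1%R]) (p t * g t)%:E = +oo)%E ->
  (* Phi Hoelder continuous on closure(Omega) x [0,oo) *)
  loc_holder_closure_halfline Omega Phi ->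
  ~ exists u : 'rV[R]_N -> R,
      [/\ Ck_on 2 Omega u,
          {within closure Omega, continuous u},
          (forall x, Omega x ->
             - laplacian u x + p (dist_bdry Omega x) * g (u x)
               <= Phi x (u x) + C * grad_norm2 u x),
          (forall x, Omega x -> 0 < u x) &
          (forall x, bdry Omega x -> u x = 0)].
Proof.
move=> N2 smooth dg _ g0 gd goo p0 pd hp hint hPhi [u [u2 uc pde upos u0]].
have N0 : (0 < N)%N by exact: ltnW.
have [neO oO _ [B OB] _] := smooth.
have [x0 [phi [e [r [c [K [ch phix0]]]]]]] := exists_chart N0 smooth.
have gd' s t : 0 < s -> s <= t -> g t <= g s.
  by move=> s0; rewrite le_eqVlt => /orP[/eqP-> //|st]; exact/ltW/gd.
have [S [S0 uS]] : exists S, 0 <= S /\ forall x, Omega x -> u x <= S.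
  have [|||y] := @EVT_max_rV R N u (closure Omega).
  - by case: neO => a Oa; exists a; exact: subset_closure.
  - exact: compact_closure_domain OB.
  - exact: uc.
  move=> _ ymax; exists `|u y|; split => // x Ox.
  apply: le_trans (ler_norm _); apply: ymax; rewrite inE.
  exact: subset_closure.
have [KF KF0 PhiK] := loc_holder_bounded hPhi neO OB S0.
have bz : bdry Omega x0.
  by apply: (chart_zero_bdry ch) => //; apply: ballxx; exact: chart_r_gt0 ch.
have dpos x : Omega x -> 0 < dist_bdry Omega x by move=> Ox; exact: dist_bdry_gt0 bz.
pose F x := p (dist_bdry Omega x) * g (u x) - Phi x (u x).
(* Replacing [C] by its absolute value only weakens the inequality and supplies the sign required by
   the comparison. *)
have uF x : Omega x -> F x <= laplacian u x + `|C| * grad_norm2 u x.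
  move=> Ox; have := pde x Ox; rewrite /F.
  have : C * grad_norm2 u x <= `|C| * grad_norm2 u x.
    by rewrite ler_wpM2r ?ler_norm // sumr_ge0 // => i _; exact: sqr_ge0.
  move: (p _ * _) (Phi _ _) (laplacian _ _) (C * _) (`|C| * _) => a b l q q'; lra.
have PhiKx x : Omega x -> Phi x (u x) <= KF.
  move=> Ox; apply: le_trans (ler_norm _) _; apply: PhiK => //.
  by rewrite uS // ltW // upos.
have FK x : Omega x -> - KF <= F x.
  move=> Ox; rewrite /F; have := PhiKx x Ox.
  have : 0 < p (dist_bdry Omega x) * g (u x).
    by rewrite mulr_gt0 ?p0 ?g0 ?dpos ?upos.
  move: (p _ * _) (Phi _ _) => a b; lra.
have [A [r' [A0 r'0 r'r HA]]] :=
  linear_bound ch phix0 (normr_ge0 C) oO u2 uc u0 uF S0 KF0 uS FK.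
have ch' := chart_shrink r'0 r'r ch.
apply: (@no_positive_subsolution R N Omega phi x0 e r' c K u F
  (fun t => p t * g t) `|C| A KF ch' phix0 (normr_ge0 C) oO u2 uc u0 uF A0 KF0 _ _ _ _ _ _ hint upos).
- by move=> x bx Ox; have [] := HA x bx Ox.
- move=> x bx Ox; have [h1 h2] := HA x bx Ox.
  have := PhiKx x Ox.
  (* Both [dist_bdry Omega x] and [u x] are at most [A * - phi x], and [p] and [g] are nonincreasing
     and positive. *)
  have : p (A * - phi x) * g (A * - phi x) <= p (dist_bdry Omega x) * g (u x).
    have AD : 0 < A * - phi x by apply: lt_le_trans h1; exact: upos.
    apply: ler_pM; try exact/ltW/p0; try exact/ltW/g0.
      by apply: pd => //; exact: dpos.
    by apply: gd' => //; exact: upos.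
  rewrite /F; move: (p _ * _) (p (dist_bdry _ _) * _) (Phi _ _) => a a' b; lra.
- move=> t t0.
  have cp := loc_holder_pos_continuous hp t0.
  have cg : {for t, continuous g}.
    by apply: (@is_derive_continuous _ _ _ ('D_1 g t)); apply: derivableP; exact: dg.
  exact: (continuousM cp cg).
- by move=> t t0; rewrite mulr_gt0 ?p0 ?g0.
- move=> s t s0 st; have t0 : 0 < t by apply: lt_le_trans st.
  apply: ler_pM; try exact/ltW/p0; try exact/ltW/g0.
    exact: pd.
  exact: gd'.
(* Blow-up of [h] at 0: for [t < 1] the factor [p t] is at least [p 1], so it is enough that [g t]
   exceeds [b / p 1]. *)
- move=> b; have p1 : 0 < p 1 by exact: p0.
  have /cvgryPgt/(_ (b / p 1)) := goo.
  move=> [d /= d0 H]; exists (Num.min d 1); first by rewrite lt_min d0 ltr01.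
  move=> t /andP[t0]; rewrite lt_min => /andP[td t1].
  have gt : b / p 1 < g t.
    by apply: H => //; rewrite /ball_ /= sub0r normrN gtr0_norm.
  apply: (@lt_le_trans _ _ (p 1 * g t)); first by rewrite mulrC -ltr_pdivrMr.
  by rewrite ler_pM2r ?g0 // pd // ltW.
Qed.
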